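(* Let $m>n$ and let $\Sigma$ be an $n$-dimensional complete (without boundary) self-shrinker properly immersed in $\mathbb{R}^m$. 1. $\Sigma$ intersects every member of the collection $\{S^{m-1}(a,\sqrt{2n+|a|^2}) : a\in\mathbb{R}^m\}$. 2. Let $a\in\mathbb{R}^m$. If $\Sigma$ lies in $\overline{B^m(a,\sqrt{2n+|a|^2})}$ or in $\mathbb{R}^m-B^m(a,\sqrt{2n+|a|^2})$, then $\Sigma\subset S^{m-1}(a,\sqrt{2n+|a|^2})$. Moreover, if in addition $n=m-1$, then $\Sigma$ is the sphere $S^n(\sqrt{2n})$ centered at the origin.
   Context: An $n$-dimensional submanifold $\Sigma$ immersed in $\mathbb{R}^m$, $m>n$, is called a self-shrinker if $\mathbf{H}=-\frac12 X^N$, where $X$ is the position vector, $X^N$ is the component of $X$ normal to $\Sigma$, and $\mathbf{H}=\sum_{i=1}^n(\nabla_{E_i}E_i)^N$ is the mean curvature vector ($\{E_i\}$ a local orthonormal tangent frame of $\Sigma$, $\nabla$ the Euclidean connection), i.e. the trace of the second fundamental form. Inclusions, intersections and equalities of $\Sigma$ with subsets of $\mathbb{R}^m$ refer to the image of the immersion. Notation: $B^m(a,R)\subset\mathbb{R}^m$ is the (open) ball with center $a$ and radius $R$, $\overline{A}$ is the closure of $A$, $S^{m-1}(a,R)\subset\mathbb{R}^m$ is the $(m-1)$-dimensional sphere with center $a$ and radius $R$, and $S^{n}(R)$ denotes the sphere centered at the origin. *)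

(* Defs.v *)
From HB Require Import structures.
From mathcomp Require Import all_boot all_order all_algebra.
From mathcomp Require Import all_classical all_reals all_analysis.

Set Implicit Arguments.
Unset Strict Implicit.
Unset Printing Implicit Defensive.

Import Order.TTheory GRing.Theory Num.Theory.
Import numFieldNormedType.Exports.
Local Open Scope classical_set_scope.
Local Open Scope ring_scope.

(* The library norm on 'rV[R]_m is the sup norm; it induces the usual topology,
   but metric notions (length, spheres, balls) need the Euclidean norm. *)
Definition dot (R : realType) (m : nat) (u v : 'rV[R]_m) : R :=
  \sum_(i < m) u 0 i * v 0 i.

Definition enorm (R : realType) (m : nat) (u : 'rV[R]_m) : R :=
  Num.sqrt (dot u u).

Definition eball (R : realType) (m : nat) (a : 'rV[R]_m) (r : R) :
    set 'rV[R]_m := [set x | enorm (x - a) < r].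

Definition esphere (R : realType) (m : nat) (a : 'rV[R]_m) (r : R) :
    set 'rV[R]_m := [set x | enorm (x - a) = r].

(* [Ck k f U]: f is of class C^k on the open set U, i.e. its iterated partial
   derivatives of order at most k exist and are continuous on U. *)
Fixpoint Ck (R : realType) (n m : nat) (k : nat) (f : 'rV[R]_n -> 'rV[R]_m)
    (U : set 'rV[R]_n) : Prop :=
  (forall u, U u -> {for u, continuous f}) /\
  match k with
  | 0%N => True
  | k'.+1 => forall i : 'I_n,
      (forall u, U u -> derivable f u (delta_mx 0 i)) /\
      Ck k' (fun u => 'D_(delta_mx 0 i) f u) U
  end.

Definition smooth_on (R : realType) (n m : nat) (f : 'rV[R]_n -> 'rV[R]_m)
    (U : set 'rV[R]_n) : Prop := forall k : nat, Ck k f U.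

(* A homeomorphism [coord] from the open set [dom] of M onto the open set [cod]
   of R^n, with inverse [param]; values outside [dom] and [cod] are irrelevant. *)
Record chart (R : realType) (n : nat) (M : topologicalType) := Chart {
  dom : set M ;
  cod : set 'rV[R]_n ;
  coord : M -> 'rV[R]_n ;
  param : 'rV[R]_n -> M ;
  dom_open : open dom ;
  cod_open : open cod ;
  coord_cod : forall p, dom p -> cod (coord p) ;
  param_dom : forall u, cod u -> dom (param u) ;
  coordK : forall p, dom p -> param (coord p) = p ;
  paramK : forall u, cod u -> coord (param u) = u ;
  coord_continuous : forall p, dom p -> {for p, continuous coord} ;
  param_continuous : forall u, cod u -> {for u, continuous param}
}.

(* Smooth n-manifolds without boundary; connectedness is not assumed. *)
Record manifold (R : realType) (n : nat) := Manifold {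
  carrier :> topologicalType ;
  manifold_hausdorff : hausdorff_space carrier ;
  manifold_second_countable : @second_countable carrier ;
  atlas : set (chart R n carrier) ;
  atlas_cover : forall p : carrier, exists2 c, atlas c & dom c p ;
  atlas_compat : forall c d, atlas c -> atlas d ->
    smooth_on (coord d \o param c) (cod c `&` param c @^-1` dom d)
}.

Definition immersion (R : realType) (n m : nat) (S : manifold R n)
    (X : S -> 'rV[R]_m) : Prop :=
  forall c, atlas c ->
    smooth_on (X \o param c) (cod c) /\
    forall u, cod c u -> injective ('d (X \o param c) u).

Definition proper_map (T U : topologicalType) (f : T -> U) : Prop :=
  forall K : set U, compact K -> compact (f @^-1` K).

(* Orthogonal projection of v onto the complement of the row space of T:
   the row space of [kermx T^T] is that orthogonal complement. *)
Definition normal_part (R : realType) (n m : nat) (T : 'M[R]_(n, m))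
    (v : 'rV[R]_m) : 'rV[R]_m := v *m proj_mx (kermx T^T) <<T>>%MS.

(* A tangent frame along a local parametrization F is given by its coordinate
   vector fields e_i on R^n; the frame itself is E_i = dF(e_i). *)
Definition frame_vector (R : realType) (n m : nat) (F : 'rV[R]_n -> 'rV[R]_m)
    (e : 'I_n -> 'rV[R]_n -> 'rV[R]_n) (i : 'I_n) (u : 'rV[R]_n) : 'rV[R]_m :=
  'd F u (e i u).

Definition orthonormal_frame (R : realType) (n m : nat)
    (F : 'rV[R]_n -> 'rV[R]_m) (e : 'I_n -> 'rV[R]_n -> 'rV[R]_n)
    (V : set 'rV[R]_n) : Prop :=
  (forall i, smooth_on (e i) V) /\
  (forall u, V u -> forall i j,
     dot (frame_vector F e i u) (frame_vector F e j u) = (i == j)%:R).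

(* H = \sum_i (\nabla_{E_i} E_i)^N, where \nabla_{E_i} is differentiation along
   e_i in the parameter domain. The sum does not depend on the frame, and the
   rows of the jacobian span the tangent space. *)
Definition is_mean_curvature (R : realType) (n m : nat)
    (F : 'rV[R]_n -> 'rV[R]_m) (u : 'rV[R]_n) (H : 'rV[R]_m) : Prop :=
  exists (e : 'I_n -> 'rV[R]_n -> 'rV[R]_n) (V : set 'rV[R]_n),
    [/\ open V, V u, orthonormal_frame F e V &
      H = \sum_(i < n)
            normal_part (jacobian F u) ('D_(e i u) (frame_vector F e i) u)].

Definition self_shrinker (R : realType) (n m : nat) (S : manifold R n)
    (X : S -> 'rV[R]_m) : Prop :=
  immersion X /\
  forall c, atlas c -> forall u, cod c u ->
    is_mean_curvature (X \o param c) u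
      (- 2^-1 *: normal_part (jacobian (X \o param c) u) (X (param c u))).

(* For an immersion X, a continuous curve g in S is C^1 iff X \o g is, and its
   Riemannian speed is |(X \o g)'|. No regularity (g' <> 0) is required, so that
   every piecewise C^1 curve on [0, 1] can be reparametrized, with the same
   length, as a restriction of a curve of this kind. *)
Definition C1_curve (R : realType) (n m : nat) (S : manifold R n)
    (X : S -> 'rV[R]_m) (g : R -> S) : Prop :=
  [/\ continuous g, forall t, derivable (X \o g) t 1
    & continuous (derive1 (X \o g))].

Definition curve_length (R : realType) (n m : nat) (S : manifold R n)
    (X : S -> 'rV[R]_m) (g : R -> S) : \bar R :=
  (\int[lebesgue_measure]_(t in `[0%R, 1%R]) (enorm (derive1 (X \o g) t))%:E)%E.

(* The Riemannian distance of the metric induced by X, equal to +oo between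
   distinct connected components. *)
Definition intrinsic_dist (R : realType) (n m : nat) (S : manifold R n)
    (X : S -> 'rV[R]_m) (p q : S) : \bar R :=
  ereal_inf [set curve_length X g | g in
    [set g : R -> S | [/\ C1_curve X g, g 0 = p & g 1 = q]]].

Definition complete_immersed (R : realType) (n m : nat) (S : manifold R n)
    (X : S -> 'rV[R]_m) : Prop :=
  forall x : nat -> S,
    (forall eps : R, 0 < eps -> exists N : nat, forall i j : nat,
       (N <= i)%N -> (N <= j)%N -> (intrinsic_dist X (x i) (x j) < eps%:E)%E) ->
    exists p : S, forall eps : R, 0 < eps -> exists N : nat, forall i : nat,
      (N <= i)%N -> (intrinsic_dist X (x i) p < eps%:E)%E.

(* Main.v *)
Require Import Defs.
From HB Require Import structures.
From mathcomp Require Import all_boot all_order all_algebra.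
From mathcomp Require Import all_classical all_reals all_analysis.
From mathcomp Require Import ring lra.
Set Implicit Arguments.
Unset Strict Implicit.
Unset Printing Implicit Defensive.
Import Order.TTheory GRing.Theory Num.Theory.
Import numFieldNormedType.Exports.
Local Open Scope classical_set_scope.
Local Open Scope ring_scope.

(** For a self-shrinker the drift Laplacian
      L f = Delta f - 1/2 <X^T, grad f>
    acts on restrictions of ambient functions by a formula that contains no
    curvature: since H = - X^N / 2,
      L (G o X) = sum_i Hess G (E_i, E_i) - 1/2 <grad G (X), X>
    for any orthonormal basis E of the tangent space.  The position of X with
    respect to the sphere S(a, sqrt (2n + |a|^2)) is measured by the power
      |X - a|^2 - (2n + |a|^2) = <X - 2a, X> - 2n,
    and the formula gives L |X - 2a|^2 = 2n - <X - 2a, X>, the opposite of that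
    power.  So a one-sided position with respect to the sphere makes
    f = |X - 2a|^2 superharmonic (outside) or subharmonic (inside).  Properness
    lets f attain its minimum (outside), or its maximum (inside, where the part
    of the surface under consideration is compact), so no integration over the
    surface and no bound on its volume growth are used.

    If no point of the surface were on the sphere, the points strictly outside
    and those strictly inside would form two clopen sets; on a nonempty one the
    extremum of f contradicts the sign of L f ([sphere_power_vanishes]).

    If the surface lies on one side, the strong maximum principle
    ([strong_maximum_principle]) makes f constant on each connected component,
    whence L f = 0 and the power vanishes ([one_sided_on_sphere]).  Then
    |X - 2a|^2 and <X - 2a, X> are both constant on the component, hence so is
    <a, X>; as L <a, X> = - <a, X> / 2, this constant is 0 and |X|^2 = 2n.

    For a hypersurface, let x be a point with |x|^2 = 2n and let X(q) maximize
    <x, X>.  Both x and X(q) are normal to the surface at q, so they are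
    collinear, and L <x, X> <= 0 at q says <x, X(q)> >= 0; therefore x = X(q)
    ([hypersurface_covers_sphere]).

    The strong maximum principle is proved in a chart, but with a barrier
    exp (- alpha |X - y|^2) built from the ambient distance to a point y = X(v)
    of the surface itself.  The formula for L then applies to it, and all that
    is needed of the immersion is that near a point the tangential part of
    X(u) - X(v) is at least a multiple of |u - v|
    ([tangential_increment_lower_bound]). *)

(** * Inner product, orthonormal families, normal part *)

Section InnerProduct.
Variables (R : realType) (m : nat).
Implicit Types (u v w : 'rV[R]_m) (k : R).

Lemma dotC u v : dot u v = dot v u.
Proof. by apply: eq_bigr => i _; rewrite mulrC. Qed.

Lemma dotDl u v w : dot (u + v) w = dot u w + dot v w.
Proof.
by rewrite /dot -big_split/=; apply: eq_bigr => i _; rewrite mxE mulrDl.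
Qed.

Lemma dotZl k u v : dot (k *: u) v = k * dot u v.
Proof. by rewrite /dot mulr_sumr; apply: eq_bigr => i _; rewrite mxE mulrA. Qed.

Lemma dotNl u v : dot (- u) v = - dot u v.
Proof. by rewrite -scaleN1r dotZl mulN1r. Qed.

Lemma dotBl u v w : dot (u - v) w = dot u w - dot v w.
Proof. by rewrite dotDl dotNl. Qed.

Lemma dot0l v : dot 0 v = 0.
Proof. by rewrite -(scale0r 0) dotZl mul0r. Qed.

Lemma dotDr u v w : dot w (u + v) = dot w u + dot w v.
Proof. by rewrite dotC dotDl !(dotC w). Qed.

Lemma dotZr k u v : dot u (k *: v) = k * dot u v.
Proof. by rewrite dotC dotZl dotC. Qed.

Lemma dotNr u v : dot u (- v) = - dot u v.
Proof. by rewrite dotC dotNl dotC. Qed.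

Lemma dotBr u v w : dot w (u - v) = dot w u - dot w v.
Proof. by rewrite dotDr dotNr. Qed.

Lemma dot0r v : dot v 0 = 0.
Proof. by rewrite dotC dot0l. Qed.

Lemma dot_sumr (I : Type) (r : seq I) (P : pred I) (F : I -> 'rV[R]_m) v :
  dot v (\sum_(i <- r | P i) F i) = \sum_(i <- r | P i) dot v (F i).
Proof.
by apply: (big_morph (dot v)) => [x y|]; [exact: dotDr|exact: dot0r].
Qed.

Lemma dot_suml (I : Type) (r : seq I) (P : pred I) (F : I -> 'rV[R]_m) v :
  dot (\sum_(i <- r | P i) F i) v = \sum_(i <- r | P i) dot (F i) v.
Proof. by rewrite dotC dot_sumr; apply: eq_bigr => i _; rewrite dotC. Qed.

Lemma dot_ge0 u : 0 <= dot u u.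
Proof. by apply: sumr_ge0 => i _; rewrite -expr2 sqr_ge0. Qed.

Lemma dot_eq0 u : dot u u = 0 -> u = 0.
Proof.
move=> /eqP; rewrite psumr_eq0 => [|i _]; last by rewrite -expr2 sqr_ge0.
move=> /allP u0; apply/rowP => i; rewrite mxE.
by have := u0 i (mem_index_enum _); rewrite -expr2 sqrf_eq0 => /eqP.
Qed.

Lemma dot_mxE u v : dot u v = (u *m v^T) 0 0.
Proof. by rewrite !mxE; apply: eq_bigr => i _; rewrite mxE. Qed.

Lemma sqr_enorm u : enorm u ^+ 2 = dot u u.
Proof. by rewrite /enorm sqr_sqrtr// dot_ge0. Qed.

Lemma CauchySchwarz_dot u v : dot u v ^+ 2 <= dot u u * dot v v.
Proof.
have [u0|u_neq0] := eqVneq (dot u u) 0.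
  by rewrite (dot_eq0 u0) !dot0l expr0n/= mul0r.
have uu_gt0 : 0 < dot u u by rewrite lt_neqAle eq_sym u_neq0 dot_ge0.
have := dot_ge0 (dot u u *: v - dot u v *: u).
rewrite !(dotBl, dotBr, dotZl, dotZr) (dotC v u) => h.
rewrite -subr_ge0 -(pmulr_rge0 _ uu_gt0); apply: le_trans h _.
by rewrite le_eqVlt; apply/orP; left; apply/eqP; ring.
Qed.

Lemma coord_le_norm u i : `|u 0 i| <= `|u|.
Proof.
rewrite [leRHS]/Num.Def.normr/= mx_normrE.
exact: (le_bigmax _ (fun ij : 'I_1 * 'I_m => `|u ij.1 ij.2|) (0, i)).
Qed.

Lemma norm_le_coord u k : 0 <= k -> (forall i, `|u 0 i| <= k) -> `|u| <= k.
Proof.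
move=> k_ge0 uk; rewrite [leLHS]/Num.Def.normr/= mx_normrE.
by apply: bigmax_le => // -[i j] _ /=; rewrite ord1.
Qed.

(** The topology of row vectors comes from the sup norm and the geometry from
    the inner product; this inequality and the next one translate between them. *)
Lemma dot_le_norm u : dot u u <= m%:R * `|u| ^+ 2.
Proof.
rewrite /dot; apply: (@le_trans _ _ (\sum_(i < m) `|u| ^+ 2)).
  apply: ler_sum => i _; rewrite -expr2 -real_normK ?num_real//.
  by rewrite lerXn2r ?nnegrE// coord_le_norm.
by rewrite sumr_const card_ord mulr_natl lexx.
Qed.

Lemma norm_le_dot u : `|u| ^+ 2 <= dot u u.
Proof.
have [->|u_neq0] := eqVneq u 0; first by rewrite normr0 expr0n/= dot0l.
have /mx_norm_neq0[[i j] /= uij] : mx_norm u != 0.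
  by apply: contra_neq u_neq0 => /mx_norm_eq0.
rewrite [`|u|]uij ord1 /dot (bigD1 j)//= real_normK ?num_real// -expr2 lerDl.
by apply: sumr_ge0 => k _; rewrite -expr2 sqr_ge0.
Qed.

End InnerProduct.

Definition orthonormal_family (R : realType) (n m : nat)
    (E : 'I_n -> 'rV[R]_m) : Prop :=
  forall i j, dot (E i) (E j) = (i == j)%:R.

Section OrthonormalFamilies.
Variables (R : realType) (n m : nat) (E : 'I_n -> 'rV[R]_m).
Hypothesis E_orthonormal : orthonormal_family E.

Lemma dot_orthonormal_sum (c : 'I_n -> R) j :
  dot (\sum_i c i *: E i) (E j) = c j.
Proof.
rewrite dot_suml (bigD1 j)//= dotZl E_orthonormal eqxx mulr1 big1 ?addr0//.
by move=> i /negPf ij; rewrite dotZl E_orthonormal ij mulr0.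
Qed.

Lemma Bessel (x : 'rV[R]_m) : \sum_i dot x (E i) ^+ 2 <= dot x x.
Proof.
pose p := \sum_i dot x (E i) *: E i.
have dotp v : dot v p = \sum_i dot x (E i) * dot v (E i).
  by rewrite dot_sumr; apply: eq_bigr => i _; rewrite dotZr.
have px : dot x p = \sum_i dot x (E i) ^+ 2 by rewrite dotp.
have pp : dot p p = \sum_i dot x (E i) ^+ 2.
  by rewrite dotp; apply: eq_bigr => i _; rewrite dot_orthonormal_sum.
have := dot_ge0 (x - p); rewrite dotBl !dotBr (dotC p x) px pp subrr subr0.
by rewrite subr_ge0.
Qed.

(** Cauchy-Schwarz in the coordinates of the frame: the tangential part of x,
    whose squared length is the sum on the right, is at least as long as the
    component of x along any single tangent vector w. *)
Lemma sqr_dot_span_le (x w : 'rV[R]_m) (c : 'I_n -> R) :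
  w = \sum_i c i *: E i ->
  dot x w ^+ 2 <= dot w w * \sum_i dot x (E i) ^+ 2.
Proof.
move=> wE.
have xw y : dot y w = dot (\row_i c i) (\row_i dot y (E i)).
  by rewrite wE dot_sumr; apply: eq_bigr => i _; rewrite dotZr !mxE.
have ww : dot w w = dot (\row_i c i) (\row_i c i).
  by rewrite xw; congr dot; apply/rowP => i; rewrite !mxE wE dot_orthonormal_sum.
have -> : \sum_i dot x (E i) ^+ 2 = dot (\row_i dot x (E i)) (\row_i dot x (E i)).
  by apply: eq_bigr => i _; rewrite mxE -expr2.
by rewrite xw ww; exact: CauchySchwarz_dot.
Qed.

End OrthonormalFamilies.

(** The orthogonal complement of the family has rank at most 1, so this is the
    equality case of Cauchy-Schwarz. *)
Lemma orthonormal_codim1_collinear (R : realType) (n m : nat)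
    (E : 'I_n -> 'rV[R]_m) (x y : 'rV[R]_m) : (m <= n.+1)%N ->
  orthonormal_family E ->
  (forall i, dot x (E i) = 0) -> (forall i, dot y (E i) = 0) ->
  dot x y ^+ 2 = dot x x * dot y y.
Proof.
move=> codim E_on xE yE; pose M : 'M[R]_(n, m) := \matrix_(i, j) E i 0 j.
have MM : M *m M^T = 1%:M.
  apply/matrixP => i j; rewrite [RHS]mxE -E_on !mxE.
  by apply: eq_bigr => k _; rewrite !mxE.
have ker_rank : (\rank (kermx M^T) <= 1)%N.
  have /eqP rankM : row_free M by apply/row_freeP; exists M^T.
  by rewrite mxrank_ker mxrank_tr rankM leq_subLR addn1.
have inker z : (forall i, dot z (E i) = 0) -> (z <= kermx M^T)%MS.
  move=> zE; apply/sub_kermxP; apply/rowP => i; rewrite [RHS]mxE -(zE i) mxE.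
  by apply: eq_bigr => k _; rewrite !mxE.
have [->|x_neq0] := eqVneq x 0; first by rewrite !dot0l expr0n/= mul0r.
have /submxP[t yt] : (y <= x)%MS.
  apply: submx_trans (inker _ yE) _.
  have /mxrank_leqif_sup[_ <-] := inker _ xE.
  rewrite eqn_leq mxrankS ?inker//=; apply: leq_trans ker_rank _.
  by rewrite rank_rV x_neq0.
have {}yt : y = t 0 0 *: x by rewrite yt [t]mx11_scalar mul_scalar_mx mxE eqxx.
by rewrite yt !(dotZl, dotZr); ring.
Qed.

Section NormalPart.
Variables (R : realType) (n m : nat) (T : 'M[R]_(n, m)).

(** A vector of the row space of T that is orthogonal to all rows of T is
    orthogonal to itself; this is where positivity of the inner product makes
    the projection defining [normal_part] an orthogonal one. *)
Lemma normal_tangent_cap0 : (kermx T^T :&: <<T>> = 0)%MS.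
Proof.
apply/eqP/rowV0P => v; rewrite sub_capmx => /andP[/sub_kermxP vT].
rewrite genmxE => /submxP[w vE].
by apply: dot_eq0; rewrite dot_mxE {2}vE trmx_mul mulmxA vT mul0mx mxE.
Qed.

Lemma normal_tangent_full (v : 'rV[R]_m) : (v <= kermx T^T + <<T>>)%MS.
Proof.
apply: submx_full; rewrite /row_full mxrank_disjoint_sum.
  by rewrite mxrank_ker mxrank_gen mxrank_tr subnK// rank_leq_col.
exact: normal_tangent_cap0.
Qed.

Lemma normal_part_sub (v : 'rV[R]_m) :
  exists w : 'rV[R]_n, v = normal_part T v + w *m T.
Proof.
have /submxP[w wE] : (v *m proj_mx <<T>> (kermx T^T) <= T)%MS.
  by rewrite -(genmxE T) proj_mx_sub.
exists w; rewrite -wE /normal_part add_proj_mx//.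
  exact: normal_tangent_cap0.
exact: normal_tangent_full.
Qed.

(** In the second order test x is the gradient of a function at a critical
    point: it only sees normal parts, which are what the shrinker equation
    controls. *)
Lemma dot_normal_part (x v : 'rV[R]_m) :
  (forall w : 'rV[R]_n, dot x (w *m T) = 0) ->
  dot x (normal_part T v) = dot x v.
Proof.
move=> xT; have [w vE] := normal_part_sub v.
by rewrite {2}vE dotDr xT addr0.
Qed.

End NormalPart.

(** * Maps with continuous partial derivatives *)

Lemma is_derive_line (R : realType) (V W : normedModType R) (f : V -> W)
    (x v : V) (t : R) (df : W) :
  is_derive (x + t *: v) v f df -> is_derive t 1 (fun s : R => f (x + s *: v)) df.
Proof.
set g := fun s : R => f (x + s *: v).
have E : (fun h : R =>
      h^-1 *: ((f \o shift (x + t *: v)) (h *: v) - f (x + t *: v)))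
    = (fun h : R => h^-1 *: ((g \o shift t) (h *: (1 : R)) - g t)).
  apply/funext => h /=; congr (_ *: (f _ - _)).
  by rewrite scalerDl scaler1 addrCA.
by move=> [dfx dfE]; split; [rewrite /derivable -E|rewrite /derive -E].
Qed.

Lemma increment_le (R : realType) (g : R -> R) (t0 d c e : R) :
  (forall t, `|t - t0| <= d -> derivable g t 1 /\ `|'D_1 g t - c| <= e) ->
  forall a b, `|a - t0| <= d -> `|b - t0| <= d ->
  `|g b - g a - (b - a) * c| <= e * `|b - a|.
Proof.
move=> dg a b; wlog ab : a b / a <= b => [wlog_ab ad bd|].
  have [|/ltW ba] := leP a b; first by move=> /wlog_ab; apply.
  have -> : g b - g a - (b - a) * c = - (g a - g b - (a - b) * c) by ring.
  by rewrite normrN (distrC b); exact: wlog_ab.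
move=> ad bd.
have itvd t : t \in `[a, b] -> `|t - t0| <= d.
  rewrite in_itv/= => /andP[ta tb]; move: ad bd; rewrite !ler_norml.
  by move=> /andP[? ?] /andP[? ?]; apply/andP; split; lra.
have [t tab E] : exists2 t, t \in `[a, b]%R & g b - g a = 'D_1 g t * (b - a).
  apply: MVT_segment => // [t tab|].
    apply: derivableP; apply: (dg _ _).1; apply: itvd.
    exact: subset_itv_oo_cc tab.
  apply: derivable_within_continuous => t tab.
  by apply: (dg _ _).1; exact: itvd.
rewrite E (mulrC (b - a)) -mulrBl normrM.
by apply: ler_wpM2r => //; apply: (dg _ _).2; exact: itvd.
Qed.

(** The increment from u to v is split along a path that changes one coordinate
    at a time, and the mean value theorem applies to each step.  Balls of the sup
    norm are boxes, so the path stays in the ball. *)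
Lemma increment_coord_le (R : realType) (n : nat) (f : 'rV[R]_n -> R)
    (u0 : 'rV[R]_n) (d e : R) (c : 'I_n -> R) :
  (forall u i, `|u - u0| <= d ->
     derivable f u (delta_mx 0 i) /\ `|'D_(delta_mx 0 i) f u - c i| <= e) ->
  forall u v, `|u - u0| <= d -> `|v - u0| <= d ->
  `|f v - f u - \sum_i (v - u) 0 i * c i| <= \sum_i e * `|(v - u) 0 i|.
Proof.
move=> df u v ud vd.
have d_ge0 : 0 <= d := le_trans (normr_ge0 _) ud.
(* w k agrees with v on the first k coordinates and with u on the others *)
pose w (k : nat) : 'rV[R]_n := \row_i (if (i < k)%N then v 0 i else u 0 i).
have w0 : w 0%N = u by apply/rowP => i; rewrite mxE ltn0.
have wn : w n = v by apply/rowP => i; rewrite mxE ltn_ord.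
have -> : f v - f u = \sum_(k < n) (f (w k.+1) - f (w k)).
  by rewrite -w0 -{1}wn -(telescope_sumr (f \o w) (leq0n n)) big_mkord.
rewrite -sumrB; apply: le_trans (ler_norm_sum _ _ _) _.
apply: ler_sum => k _.
pose z : 'rV[R]_n := w k - u 0 k *: delta_mx 0 k.
have zE t i : (z + t *: delta_mx 0 k) 0 i =
    if i == k then t else w k 0 i.
  rewrite !mxE eqxx/=; case: eqVneq => [->|_]; last by rewrite !mulr0 subr0 addr0.
  by rewrite ltnn !mulr1 subrr add0r.
have -> : w k = z + u 0 k *: delta_mx 0 k by rewrite subrK.
have -> : w k.+1 = z + v 0 k *: delta_mx 0 k.
  apply/rowP => i; rewrite zE !mxE ltnS leq_eqVlt.
  case: (eqVneq i k) => [->|/negPf ik]; first by rewrite eqxx.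
  by have -> : (i == k :> nat) = false := ik.
rewrite !mxE.
apply: (@increment_le _ (fun t => f (z + t *: delta_mx 0 k)) (u0 0 k) d).
- move=> t td.
  have zd : `|z + t *: delta_mx 0 k - u0| <= d.
    apply: norm_le_coord => // i; rewrite mxE zE [(- u0) 0 i]mxE.
    case: eqVneq => [->//|_]; rewrite mxE.
    have := le_trans (coord_le_norm _ i) ud.
    have := le_trans (coord_le_norm _ i) vd.
    by rewrite !mxE; case: ifP.
  have [dfz ce] := df _ k zd.
  have := is_derive_line (derivableP dfz) => -[dft dfE].
  by split => //; rewrite dfE.
- by have := le_trans (coord_le_norm _ k) ud; rewrite !mxE.
- by have := le_trans (coord_le_norm _ k) vd; rewrite !mxE.
Qed.

Lemma differentiable_linear_approx (R : realType) (V W : normedModType R)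
    (f : V -> W) (L : {linear V -> W}) (x : V) : continuous L ->
  (forall e : R, 0 < e ->
     \forall h \near 0, `|f (h + x) - f x - L h| <= e * `|h|) ->
  differentiable f x.
Proof.
move=> Lcont fL.
have E : f \o shift x = cst (f x) + L +o_ 0 id.
  apply/eqaddoP => e e_gt0; have := fL e e_gt0.
  by apply: filterS => h; rewrite !fctE/= opprD addrA.
by apply/diff_locallyP; rewrite (diff_unique Lcont E).
Qed.

Section C1.
Variables (R : realType) (n m : nat) (f : 'rV[R]_n -> 'rV[R]_m).
Variable U : set 'rV[R]_n.
Hypotheses (openU : open U) (f_C1 : Ck 1 f U).

Let D i u := 'D_(delta_mx 0 i) f u.

(** Besides differentiability, the estimate for two moving points u and v is what
    later bounds tangential increments from below. *)
Lemma C1_strictly_differentiable u0 (e : R) : U u0 -> 0 < e ->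
  exists2 d : R, 0 < d & forall u, `|u - u0| <= d ->
    [/\ U u, forall i, `|D i u - D i u0| <= e &
        forall v, `|v - u0| <= d ->
          `|f v - f u - \sum_i (v - u) 0 i *: D i u0| <= e * `|v - u|].
Proof.
move=> Uu0 e_gt0; pose e' := e / n.+1%:R.
(* the n partial increments contribute e' each; the successor covers n = 0 *)
have e'_gt0 : 0 < e' by rewrite divr_gt0.
have e'e : e' <= e by rewrite ler_pdivrMr// ler_peMr ?(ltW e_gt0)// ler1n.
have : \forall u \near u0, U u /\ forall i, `|D i u - D i u0| <= e'.
  have nearU : \forall u \near u0, U u by exact: open_nbhs_nbhs.
  have nearD : \forall u \near u0, forall i, `|D i u - D i u0| <= e'.
    apply: (@filter_forall _ _ (fun i u => `|D i u - D i u0| <= e') (nbhs u0)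
      (nbhs_filter u0)) => i.
    have [_ [cD _]] := f_C1.2 i.
    have /cvgrPdist_le/(_ _ e'_gt0) := cD u0 Uu0.
    by apply: filterS => u; rewrite distrC.
  by apply: filterS2 nearU nearD => u.
move=> /nbhs_ballP[d /= d_gt0 dP].
exists (d / 2); first by rewrite divr_gt0.
have {}dP u : `|u - u0| <= d / 2 -> U u /\ forall i, `|D i u - D i u0| <= e'.
  move=> ud; apply: dP; rewrite -ball_normE/= distrC.
  by apply: le_lt_trans ud _; rewrite ltr_pdivrMr// ltr_pMr// ltr1n.
move=> u ud; split; [exact: (dP u ud).1| |].
  by move=> i; exact: le_trans ((dP u ud).2 i) e'e.
move=> v vd; apply: norm_le_coord => [|j].
  by rewrite mulr_ge0// ltW.
have := @increment_coord_le _ _ (fun x => f x 0 j) u0 (d / 2) e'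
  (fun i => D i u0 0 j) _ u v ud vd.
rewrite !mxE summxE => h.
under eq_bigr do rewrite mxE.
apply: (le_trans (h _)) => [x i xd|].
  have [Ux Dx] := dP x xd.
  have fxi : derivable f x (delta_mx 0 i) := (f_C1.2 i).1 x Ux.
  split; first exact: (derivable_mxP _ _ _).1.
  have := le_trans (coord_le_norm _ j) (Dx i).
  by rewrite !mxE /D (derive_mx fxi) !mxE.
apply: (@le_trans _ _ (\sum_(i < n) e' * `|v - u|)).
  by apply: ler_sum => i _; rewrite ler_wpM2l ?(ltW e'_gt0)// coord_le_norm.
rewrite sumr_const card_ord -mulrnAl ler_wpM2r//.
by rewrite -mulr_natr /e' -mulrA ler_piMr ?ltW// mulrC ltr_pdivrMr// mul1r ltr_nat.
Qed.

Lemma C1_differentiable u : U u -> differentiable f u.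
Proof.
move=> Uu.
pose L : {linear 'rV[R]_n -> 'rV[R]_m} := mulmxr (\matrix_(i, j) D i u 0 j).
have LE : L = \sum_i (fun v : 'rV[R]_n => v 0 i *: D i u) :> (_ -> _).
  apply/funext => v; apply/rowP => j; rewrite fct_sumE summxE mxE.
  by apply: eq_bigr => i _; rewrite !mxE.
have Lcont : continuous L.
  move=> x; rewrite LE; apply: differentiable_continuous.
  apply: differentiable_sum => i; apply: differentiableZl.
  exact: differentiable_coord.
apply: (@differentiable_linear_approx _ _ _ f L) => // e e_gt0.
have [d d_gt0 dP] := C1_strictly_differentiable Uu e_gt0.
have := @nbhs0_le _ 'rV[R]_n d d_gt0; apply: filterS => h hd.
have [|_ _ /(_ (h + u))] := dP u; first by rewrite subrr normr0 ltW.
by rewrite addrK LE fct_sumE; apply.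
Qed.

End C1.

(** * Second order test on a self-shrinker *)

Section RowDerivative.
Variables (R : realType) (V : normedModType R) (m : nat).
Implicit Types (f g : V -> 'rV[R]_m) (x v : V).

Lemma is_derive_coord f x v (df : 'rV[R]_m) j :
  is_derive x v f df -> is_derive x v (fun y => f y 0 j) (df 0 j).
Proof.
move=> [fxv <-]; rewrite (derive_mx fxv) mxE; apply: derivableP.
exact: (derivable_mxP _ _ _).1.
Qed.

Lemma is_derive_row f x v (df : 'rV[R]_m) :
  (forall j, is_derive x v (fun y => f y 0 j) (df 0 j)) -> is_derive x v f df.
Proof.
move=> fj.
have fxv : derivable f x v.
  by apply/derivable_mxP => i j; rewrite ord1; have [] := fj j.
split => //; apply/rowP => j; rewrite (derive_mx fxv) mxE.
by have [] := fj j.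
Qed.

Lemma is_derive_sum_fun (I : finType) (h : I -> V -> R) x v (dh : I -> R) :
  (forall i, is_derive x v (h i) (dh i)) ->
  is_derive x v (fun y => \sum_i h i y) (\sum_i dh i).
Proof.
move=> hd; rewrite -fct_sumE; elim/big_ind2 : _ => // [|f df g dg ? ?].
  exact: is_derive_cst.
exact: is_deriveD.
Qed.

Lemma is_derive_dot f g x v (df dg : 'rV[R]_m) :
  is_derive x v f df -> is_derive x v g dg ->
  is_derive x v (fun y => dot (f y) (g y)) (dot df (g x) + dot (f x) dg).
Proof.
move=> fd gd; rewrite /dot -big_split/=; apply: is_derive_sum_fun => i.
apply: is_derive_eq.
  by apply: is_deriveM; apply: is_derive_coord; eassumption.
by rewrite addrC; congr (_ + _); exact: mulrC.
Qed.

End RowDerivative.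

(** If L were negative, q would be negative immediately to the right of 0, and
    the mean value theorem would make k decrease there. *)
Lemma local_min_second_order (R : realType) (k q : R -> R) (L : R) :
  (\forall t \near (0 : R), is_derive t (1 : R) k (q t)) ->
  is_derive (0 : R) 1 q L ->
  (\forall t \near (0 : R), k 0 <= k t) -> q 0 = 0 /\ 0 <= L.
Proof.
move=> kq qL kmin.
have [d /= d_gt0 dP] : exists2 d : R, 0 < d & forall t, `|t| < d ->
    is_derive t (1 : R) k (q t) /\ k 0 <= k t.
  have : \forall t \near (0:R), is_derive t (1 : R) k (q t) /\ k 0 <= k t.
    by apply: filterS2 kq kmin => t.
  move=> /nbhs_ballP[d /= d_gt0 dP]; exists d => // t td.
  by apply: dP; rewrite -ball_normE/= sub0r normrN.
have itvd t : t \in `]-d, d[ -> `|t| < d by rewrite in_itv/= ltr_norml.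
have q0 : q 0 = 0.
  have [_ <-] : is_derive (0 : R) (1 : R) k (q 0).
    by apply: (dP 0 _).1; rewrite normr0.
  apply: (@derive_val _ _ _ _ _ _ _ _).
  apply: (@derive1_at_min _ k (- d) d).
  - by rewrite ge0_cp ?ltW.
  - by move=> t /itvd /dP[[]].
  - by rewrite in_itv/= oppr_lt0 d_gt0.
  - by move=> t /itvd /dP[].
split=> //; rewrite leNgt; apply/negP => L_lt0.
have [q'cvg q'E] := qL.
have : (fun h => h^-1 *: ((q \o shift 0) (h *: (1 : R)) - q 0)) @ 0^' --> L.
  by rewrite -q'E.
move=> /cvgr_lt/(_ _ L_lt0) /nbhs_ballP[r /= r_gt0 rP].
pose s := Num.min (d / 2) (r / 2).
have s_gt0 : 0 < s by rewrite lt_min !divr_gt0.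
have sd : s < d.
  by rewrite gt_min ltr_pdivrMr// ltr_pMr// ltr1n.
have sr : s < r.
  by rewrite gt_min orbC ltr_pdivrMr// ltr_pMr// ltr1n.
have [c] : exists2 c, c \in `]0, s[ & k s - k 0 = q c * (s - 0).
  apply: (MVT s_gt0) => [t|].
    rewrite in_itv/= => /andP[t0 ts]; apply: (dP _ _).1.
    by rewrite gtr0_norm// (lt_trans ts).
  apply: derivable_within_continuous => t.
  rewrite in_itv/= => /andP[t0 ts]; have [//|[]//] := dP t _.
  by rewrite ger0_norm// (le_lt_trans ts).
rewrite in_itv/= subr0 => /andP[c0 cs] E.
have : q c < 0.
  have := rP c; rewrite -ball_normE/= sub0r normrN gtr0_norm//.
  move=> /(_ (lt_trans cs sr)); rewrite gt_eqF// => /(_ isT).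
  by rewrite q0 subr0 addr0 [c%:A]mulr1 pmulr_rlt0// invr_gt0.
move=> qc; have [|_] := dP s; first by rewrite gtr0_norm.
by rewrite -subr_ge0 E leNgt => /negP; apply; rewrite nmulr_rlt0.
Qed.

(** dG is the gradient of G and HG x v the derivative of dG at x along v, that
    is the Hessian applied to v. *)
Definition has_hessian (R : realType) (m : nat) (G : 'rV[R]_m -> R)
    (dG : 'rV[R]_m -> 'rV[R]_m) (HG : 'rV[R]_m -> 'rV[R]_m -> 'rV[R]_m) : Prop :=
  (forall x, is_diff x G (dot (dG x))) /\
  (forall x i, is_diff x (fun y => dG y 0 i) (fun v => HG x v 0 i)).

(** The drift Laplacian of a function with gradient dG and Hessian HG at the
    point x of a self-shrinker with orthonormal tangent frame E. *)
Definition drift (R : realType) (n m : nat) (E : 'I_n -> 'rV[R]_m)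
    (x : 'rV[R]_m) (dG : 'rV[R]_m) (HG : 'rV[R]_m -> 'rV[R]_m) : R :=
  \sum_i dot (HG (E i)) (E i) - 2^-1 * dot dG x.

Lemma is_derive_comp (R : realType) (U V W : normedModType R) (f : U -> V)
    (g : V -> W) x v dg : differentiable f x -> is_diff (f x) g dg ->
  is_derive x v (g \o f) (dg ('d f x v)).
Proof.
move=> fx [gx <-]; split; first exact/diff_derivable/differentiable_comp.
rewrite deriveE; last exact: differentiable_comp.
by rewrite diff_comp.
Qed.

Lemma diff_sum_partial (R : realType) (n m : nat) (F : 'rV[R]_n -> 'rV[R]_m)
    u v : differentiable F u ->
  'd F u v = \sum_i v 0 i *: 'D_(delta_mx 0 i) F u.
Proof.
move=> Fu; rewrite {1}[v]row_sum_delta linear_sum.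
by apply: eq_bigr => i _; rewrite linearZ deriveE.
Qed.

Definition tangent_frame (R : realType) (n m : nat) (F : 'rV[R]_n -> 'rV[R]_m)
    (u : 'rV[R]_n) (E : 'I_n -> 'rV[R]_m) : Prop :=
  orthonormal_family E /\
  (forall v, exists c : 'I_n -> R, 'd F u v = \sum_i c i *: E i).

(** The first and second order conditions at an interior minimum, for the drift
    Laplacian. *)
Definition second_order_testable (R : realType) (n m : nat)
    (F : 'rV[R]_n -> 'rV[R]_m) (u : 'rV[R]_n) (E : 'I_n -> 'rV[R]_m) : Prop :=
  forall G dG HG, has_hessian G dG HG -> (\forall x \near u, G (F u) <= G (F x)) ->
    (forall i, dot (dG (F u)) (E i) = 0) /\
    0 <= drift E (F u) (dG (F u)) (HG (F u)).

Section SecondOrderTest.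
Variables (R : realType) (n m : nat) (F : 'rV[R]_n -> 'rV[R]_m).
Variables (U : set 'rV[R]_n) (u : 'rV[R]_n).
Hypotheses (openU : open U) (F_smooth : smooth_on F U) (Uu : U u).

Let D i := 'D_(delta_mx 0 i) F.

Let F_diff x : U x -> differentiable F x.
Proof. exact: (C1_differentiable openU (F_smooth 1)). Qed.

Let D_diff i x : U x -> differentiable (D i) x.
Proof. exact: (C1_differentiable openU ((F_smooth 2).2 i).2). Qed.

(** The second conclusion is the second derivative of G o F along the line
    through u with direction w; its last term is the gradient paired with the
    second derivative of F along w. *)
Lemma local_min_line G dG HG w : has_hessian G dG HG ->
  (\forall x \near u, G (F u) <= G (F x)) ->
  dot (dG (F u)) ('d F u w) = 0 /\
  0 <= dot (HG (F u) ('d F u w)) ('d F u w) +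
       dot (dG (F u)) (\sum_i w 0 i *: 'D_w (D i) u).
Proof.
move=> [Gd dGd] Gmin.
(* p x is the derivative of G o F at x along w, for x in U *)
pose p x := dot (dG (F x)) (\sum_i w 0 i *: D i x).
have line0 : (fun t : R => u + t *: w) @ 0 --> u.
  rewrite -[X in _ --> X]addr0 -[X in _ + X](scale0r w).
  by apply: cvgD; [exact: cvg_cst|apply: cvgZr_tmp; exact: cvg_id].
have Gline : \forall t \near (0 : R),
    is_derive t (1 : R) (fun t => G (F (u + t *: w))) (p (u + t *: w)).
  have : \forall t \near (0 : R), U (u + t *: w).
    by apply: line0; exact: open_nbhs_nbhs.
  apply: filterS => t Ut; apply: (@is_derive_line _ _ _ (G \o F)).
  rewrite /p -(diff_sum_partial _ (F_diff Ut)).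
  exact: (is_derive_comp _ (F_diff Ut)).
have pw : is_derive u w p (dot (HG (F u) ('d F u w)) ('d F u w) +
                           dot (dG (F u)) (\sum_i w 0 i *: 'D_w (D i) u)).
  rewrite {2}diff_sum_partial; last exact: F_diff.
  apply: is_derive_dot.
    apply: is_derive_row => j.
    exact: (is_derive_comp _ (F_diff Uu) (dGd _ j)).
  apply: is_derive_row => j; rewrite summxE.
  have -> : (fun x => (\sum_i w 0 i *: D i x) 0 j) =
            (fun x => \sum_i w 0 i * D i x 0 j).
    by apply/funext => x; rewrite summxE; apply: eq_bigr => i _; rewrite mxE.
  apply: is_derive_sum_fun => i; rewrite mxE.
  apply: (@is_deriveZ _ _ _ (fun x => D i x 0 j)).
  by apply/is_derive_coord/derivableP/diff_derivable/D_diff.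
pose q t := p (u + t *: w).
have -> : dot (dG (F u)) ('d F u w) = q 0.
  by rewrite /q /p scale0r addr0 -diff_sum_partial//; exact: F_diff.
have ql : is_derive (0 : R) (1 : R) q (dot (HG (F u) ('d F u w)) ('d F u w) +
    dot (dG (F u)) (\sum_i w 0 i *: 'D_w (D i) u)).
  by apply: (@is_derive_line _ _ _ p); rewrite scale0r addr0.
apply: (local_min_second_order Gline ql); rewrite scale0r addr0.
exact: (line0 _ Gmin).
Qed.

(** Differentiating E_i = dF(e_i) along e_i also differentiates the coordinates
    e_i, but this only contributes a tangent vector. *)
Lemma frame_vector_derive (e : 'I_n -> 'rV[R]_n -> 'rV[R]_n) V i :
  open V -> V u -> smooth_on (e i) V ->
  exists a : 'rV[R]_n, 'D_(e i u) (frame_vector F e i) u =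
    'd F u a + \sum_l (e i u) 0 l *: 'D_(e i u) (D l) u.
Proof.
move=> openV Vu ei; set w := e i u.
have e_diff := C1_differentiable openV (ei 1) Vu.
exists ('D_w (e i) u).
rewrite diff_sum_partial; last exact: F_diff.
rewrite -big_split/=.
have frameE : \forall x \near u,
    \sum_l (e i x) 0 l *: D l x = frame_vector F e i x.
  have : \near u, U u by exact: open_nbhs_nbhs.
  apply: filterS => x Ux; rewrite /frame_vector diff_sum_partial//.
  exact: F_diff.
rewrite -(near_eq_derive _ frameE); apply: derive_val.
apply: is_derive_row => j; rewrite summxE.
have -> : (fun x => (\sum_l (e i x) 0 l *: D l x) 0 j) =
          (fun x => \sum_l (e i x) 0 l * D l x 0 j).
  by apply/funext => x; rewrite summxE; apply: eq_bigr => l _; rewrite mxE.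
apply: is_derive_sum_fun => l; rewrite !mxE.
have el : is_derive u w (fun x => e i x 0 l) ('D_w (e i) u 0 l).
  exact/is_derive_coord/derivableP/diff_derivable.
have Dl : is_derive u w (fun x => D l x 0 j) ('D_w (D l) u 0 j).
  exact/is_derive_coord/derivableP/diff_derivable/D_diff.
apply: is_derive_eq (is_deriveM el Dl) _.
by rewrite addrC; congr (_ + _); exact: mulrC.
Qed.

(** At a minimum the gradient of G is normal, so pairing it with the derivative
    of E_i along E_i only involves the normal part; summing over i gives its
    pairing with H = - X^N / 2, which equals - <dG, X> / 2 by normality again.
    The frame is chosen before G: the strong maximum principle needs estimates
    on the frame at points found by minimizing G. *)
Lemma second_order_test :
  is_mean_curvature F u (- 2^-1 *: normal_part (jacobian F u) (F u)) ->
  exists2 E, tangent_frame F u E & second_order_testable F u E.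
Proof.
move=> [e [V [openV Vu [e_smooth e_on] H]]].
exists (fun i => frame_vector F e i u); [split|].
- exact: e_on.
- move=> v.
  (* the Gram matrix of the rows of P times the jacobian is the identity, so
     the e i u form a basis of the parameter space *)
  pose P : 'M[R]_n := \matrix_(i, j) e i u 0 j.
  have rowP i : row i P = e i u by apply/rowP => j; rewrite !mxE.
  have PJ : (P *m jacobian F u) *m (P *m jacobian F u)^T = 1%:M.
    apply/matrixP => i j; rewrite [RHS]mxE -(e_on u Vu) /frame_vector.
    rewrite -!mul_rV_lin1 -[lin1_mx _]/(jacobian F u) -!rowP -!row_mul dot_mxE.
    by rewrite !mxE; apply: eq_bigr => k _; rewrite !mxE.
  have Punit : P \in unitmx.
    by apply: (mulmx1_unit (B := jacobian F u *m (P *m jacobian F u)^T) _).1;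
      rewrite mulmxA.
  pose c := v *m invmx P; exists (fun i => c 0 i).
  have -> : v = \sum_i c 0 i *: e i u.
    rewrite -[LHS](mulmxKV Punit) -/c mulmx_sum_row.
    by apply: eq_bigr => i _; rewrite rowP.
  by rewrite linear_sum; apply: eq_bigr => i _; rewrite linearZ.
- move=> G dG HG Gtest Gmin.
  have crit w : dot (dG (F u)) ('d F u w) = 0.
    by exact: (local_min_line w Gtest Gmin).1.
  split=> [i|]; first exact: crit.
  have dotN v : dot (dG (F u)) (normal_part (jacobian F u) v) = dot (dG (F u)) v.
    by apply: dot_normal_part => w; rewrite mul_rV_lin1.
  have := congr1 (dot (dG (F u))) H.
  rewrite dotZr dotN mulNr dot_sumr /drift => ->.
  rewrite -big_split/=; apply: sumr_ge0 => i _.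
  rewrite dotN; have [a ->] := frame_vector_derive openV Vu (e_smooth i).
  rewrite dotDr crit add0r.
  exact: (local_min_line (e i u) Gtest Gmin).2.
Qed.

End SecondOrderTest.

(** * Explicit test functions *)

Section TestFunctions.
Variables (R : realType) (m : nat).
Implicit Types (G : 'rV[R]_m -> R) (b x v : 'rV[R]_m).

Lemma is_diff_directional G x dG : differentiable G x ->
  (forall v, is_derive x v G (dG v)) -> is_diff x G dG.
Proof.
move=> Gx Gv; split=> //; apply/funext => v.
by rewrite -deriveE//; have [] := Gv v.
Qed.

Lemma differentiable_dot_center b x :
  differentiable (fun y => dot (y - b) (y - b)) x.
Proof.
rewrite /dot -fct_sumE; apply: differentiable_sum => i.
have bi : differentiable (fun y : 'rV[R]_m => (y - b) 0 i) x.
  have -> : (fun y : 'rV[R]_m => (y - b) 0 i) =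
            (fun y : 'rV[R]_m => y 0 i) - cst (b 0 i).
    by apply/funext => y; rewrite !mxE fctE.
  by apply: differentiableB => //; exact: differentiable_coord.
exact: differentiableM.
Qed.

Lemma is_derive_center b x v : is_derive x v (fun y => y - b) v.
Proof.
by have := is_deriveB (is_derive_id x v) (is_derive_cst b x v); rewrite subr0.
Qed.

Lemma is_derive_dot_center b x v :
  is_derive x v (fun y => dot (y - b) (y - b)) (2 * dot (x - b) v).
Proof.
have := is_derive_dot (is_derive_center b x v) (is_derive_center b x v).
by congr is_derive; rewrite (dotC v); ring.
Qed.

Lemma has_hessian_affine b l :
  has_hessian (fun x => dot b x + l) (fun=> b) (fun _ _ => 0).
Proof.
split=> [x|x i]; last first.
  by rewrite [X in is_diff _ _ X](_ : _ = 0);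
    [exact: is_diff_cst|apply/funext => v; rewrite mxE].
apply: is_diff_directional => [|v].
  apply: differentiableD => //; rewrite /dot -fct_sumE.
  apply: differentiable_sum => i.
  by apply: differentiableM => //; exact: differentiable_coord.
have bd := is_derive_dot (is_derive_cst b x v) (is_derive_id x v).
by have := is_deriveD bd (is_derive_cst l x v); rewrite dot0l add0r addr0.
Qed.

Lemma has_hessian_sqdist b :
  has_hessian (fun x => dot (x - b) (x - b)) (fun x => 2 *: (x - b))
    (fun _ v => 2 *: v).
Proof.
split=> [x|x i].
  apply: is_diff_directional => [|v]; first exact: differentiable_dot_center.
  by rewrite dotZl; exact: is_derive_dot_center.
apply: is_diff_directional => [|v].
  have -> : (fun y : 'rV[R]_m => (2 *: (y - b)) 0 i) =
            2 *: ((fun y : 'rV[R]_m => y 0 i) - cst (b 0 i)).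
    by apply/funext => y; rewrite !mxE fctE.
  by apply/differentiableZ/differentiableB => //; exact: differentiable_coord.
apply: (is_derive_coord i (f := fun y => 2 *: (y - b))).
by apply: is_deriveZ; exact: is_derive_center.
Qed.

Lemma has_hessianD G1 dG1 HG1 G2 dG2 HG2 :
  has_hessian G1 dG1 HG1 -> has_hessian G2 dG2 HG2 ->
  has_hessian (fun x => G1 x + G2 x) (fun x => dG1 x + dG2 x)
          (fun x v => HG1 x v + HG2 x v).
Proof.
move=> [d1 h1] [d2 h2]; split=> [x|x i].
  have dD := is_diffD (d1 x) (d2 x).
  apply: (is_diff_eq dD).
  by apply/funext => v; rewrite fctE dotDl.
have -> : (fun y => (dG1 y + dG2 y) 0 i) =
          (fun y => dG1 y 0 i) + (fun y => dG2 y 0 i).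
  by apply/funext => y; rewrite mxE.
have dD := is_diffD (h1 x i) (h2 x i).
apply: (is_diff_eq dD).
by apply/funext => v; rewrite fctE mxE.
Qed.

Lemma has_hessianZ k G dG HG : has_hessian G dG HG ->
  has_hessian (fun x => k * G x) (fun x => k *: dG x) (fun x v => k *: HG x v).
Proof.
move=> [d h]; split=> [x|x i].
  have dZ := is_diffZ k (d x).
  apply: (is_diff_eq dZ).
  by apply/funext => v; rewrite fctE dotZl.
have -> : (fun y => (k *: dG y) 0 i) = k *: (fun y => dG y 0 i).
  by apply/funext => y; rewrite mxE.
have dZ := is_diffZ k (h x i).
apply: (is_diff_eq dZ).
by apply/funext => v; rewrite fctE mxE.
Qed.

Definition gaussian (al : R) b x := expR (- al * dot (x - b) (x - b)).

Lemma differentiable_gaussian al b x : differentiable (gaussian al b) x.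
Proof.
apply: (@differentiable_comp _ _ _ _ (fun y => - al * dot (y - b) (y - b)) expR).
  by apply: (@differentiableZ _ _ _ (fun y => dot (y - b) (y - b)));
    exact: differentiable_dot_center.
exact/derivable1_diffP.
Qed.

Lemma is_derive_gaussian al b x v :
  is_derive x v (gaussian al b) (- (2 * al) * gaussian al b x * dot (x - b) v).
Proof.
split; first exact/diff_derivable/differentiable_gaussian.
have qx : differentiable (fun y => - al * dot (y - b) (y - b)) x.
  by apply: (@differentiableZ _ _ _ (fun y => dot (y - b) (y - b)));
    exact: differentiable_dot_center.
rewrite deriveE; last exact: differentiable_gaussian.
rewrite (diff_comp qx); last exact/derivable1_diffP.
rewrite /= deriv1E; last exact: derivable_expR.
rewrite derive1E derive_val -deriveE//.
have qv := @is_deriveZ _ _ _ _ (- al) x v _ (is_derive_dot_center b x v).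
rewrite (@derive_val _ _ _ _ _ _ _ qv).
by rewrite /GRing.scale/= /gaussian; ring.
Qed.

Lemma has_hessian_gaussian al b :
  has_hessian (gaussian al b) (fun x => (- (2 * al) * gaussian al b x) *: (x - b))
    (fun x v => (- (2 * al) * gaussian al b x) *: v +
                ((2 * al) ^+ 2 * gaussian al b x * dot (x - b) v) *: (x - b)).
Proof.
split=> [x|x i].
  apply: is_diff_directional => [|v]; first exact: differentiable_gaussian.
  by rewrite dotZl; exact: is_derive_gaussian.
have E : (fun y : 'rV[R]_m => ((- (2 * al) * gaussian al b y) *: (y - b)) 0 i) =
         (- (2 * al) *: gaussian al b) * (fun y : 'rV[R]_m => (y - b) 0 i).
  by apply/funext => y; rewrite [LHS]mxE.
apply: is_diff_directional => [|v]; rewrite E.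
  apply: differentiableM; first exact/differentiableZ/differentiable_gaussian.
  have -> : (fun y : 'rV[R]_m => (y - b) 0 i) =
            (fun y : 'rV[R]_m => y 0 i) - cst (b 0 i).
    by apply/funext => y; rewrite !mxE fctE.
  by apply: differentiableB => //; exact: differentiable_coord.
apply: is_derive_eq (is_deriveM
  (is_deriveZ (- (2 * al)) (is_derive_gaussian al b x v))
  (is_derive_coord i (is_derive_center b x v))) _.
by rewrite /GRing.scale/= !mxE/= /GRing.scale/=; ring.
Qed.

Variables (n : nat) (E : 'I_n -> 'rV[R]_m).
Hypothesis E_orthonormal : orthonormal_family E.

Lemma driftD x p1 h1 p2 h2 :
  drift E x (p1 + p2) (fun v => h1 v + h2 v) = drift E x p1 h1 + drift E x p2 h2.
Proof.
rewrite /drift dotDl mulrDr opprD addrACA -big_split/=; congr (_ + _).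
by apply: eq_bigr => i _; rewrite dotDl.
Qed.

Lemma driftZ x k p h :
  drift E x (k *: p) (fun v => k *: h v) = k * drift E x p h.
Proof.
rewrite /drift dotZl mulrBr (mulrCA 2^-1); congr (_ - _).
by rewrite mulr_sumr; apply: eq_bigr => i _; rewrite dotZl.
Qed.

Lemma drift_affine x b : drift E x b (fun=> 0) = - 2^-1 * dot b x.
Proof. by rewrite /drift big1 => [|i _]; rewrite ?dot0l// sub0r mulNr. Qed.

(** With b = 2a this is the opposite of the power of x with respect to the
    sphere of center a and squared radius 2n + |a|^2. *)
Lemma drift_sqdist x b :
  drift E x (2 *: (x - b)) (fun v => 2 *: v) = 2 * n%:R - dot (x - b) x.
Proof.
rewrite /drift dotZl mulKf ?pnatr_eq0//; congr (_ - _).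
under eq_bigr do rewrite dotZl E_orthonormal eqxx mulr1.
by rewrite sumr_const card_ord mulr_natr.
Qed.

(** For large al this is positive wherever x - b has a tangential part bounded
    away from 0, which makes the Gaussian a barrier. *)
Lemma drift_gaussian al b x :
  drift E x ((- (2 * al) * gaussian al b x) *: (x - b))
    (fun v => (- (2 * al) * gaussian al b x) *: v +
                ((2 * al) ^+ 2 * gaussian al b x * dot (x - b) v) *: (x - b)) =
  al * gaussian al b x *
  (4 * al * (\sum_i dot (x - b) (E i) ^+ 2) - 2 * n%:R + dot (x - b) x).
Proof.
rewrite /drift dotZl /=; set w := x - b.
rewrite (eq_bigr (fun i => - (2 * al) * gaussian al b x +
    (2 * al) ^+ 2 * gaussian al b x * dot w (E i) ^+ 2)) => [|i _]; last first.
  by rewrite dotDl !dotZl E_orthonormal eqxx mulr1; ring.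
rewrite big_split/= sumr_const card_ord -mulr_sumr -mulr_natl.
by field.
Qed.

End TestFunctions.

(** * Strong maximum principle *)

Lemma norm_sum_coord_le (R : realType) (n m : nat) (a : 'I_n -> 'rV[R]_m)
    (x : 'rV[R]_n) (e : R) : (forall i, `|a i| <= e) ->
  `|\sum_i x 0 i *: a i| <= n%:R * e * `|x|.
Proof.
move=> ae; apply: le_trans (ler_norm_sum _ _ _) _.
apply: (@le_trans _ _ (\sum_(i < n) e * `|x|)).
  apply: ler_sum => i _; rewrite normrZ mulrC.
  by apply: ler_pM => //; exact: coord_le_norm.
by rewrite sumr_const card_ord -mulrA mulr_natl lexx.
Qed.

(** An injective linear map of finite rank has a left inverse, the matrix B, and
    the constant is the inverse of a bound on the norm of B. *)
Lemma injective_diff_lower_bound (R : realType) (n m : nat)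
    (F : 'rV[R]_n -> 'rV[R]_m) u : injective ('d F u) ->
  exists2 c : R, 0 < c & forall v, c * `|v| <= `|'d F u v|.
Proof.
move=> Finj.
have /row_freeP[B JB] : row_free (jacobian F u).
  apply: inj_row_free => v; rewrite mul_rV_lin1 -(linear0 ('d F u)).
  exact: Finj.
pose C := \sum_j `|row j B|.
have C_ge0 : 0 <= C by apply: sumr_ge0.
exists (m%:R * C + 1)^-1 => [|v]; first by rewrite invr_gt0 ltr_wpDl// mulr_ge0.
rewrite mulrC ler_pdivrMr; last by rewrite ltr_wpDl// mulr_ge0.
have vB : v = 'd F u v *m B by rewrite -mul_rV_lin1 -mulmxA JB mulmx1.
rewrite {1}vB mulmx_sum_row.
apply: le_trans (@norm_sum_coord_le _ _ _ _ _ C _) _.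
  by move=> i; rewrite /C (bigD1 i)//= lerDl; apply: sumr_ge0.
by rewrite [leRHS]mulrC ler_wpM2r// lerDl.
Qed.

(** Near u0 the increment of F from v to u is dF_u (u - v), a tangent vector at
    u, up to an error that is small with respect to |u - v|; since dF_u is
    bounded from below, most of the increment is tangential at u. *)
Lemma tangential_increment_lower_bound (R : realType) (n m : nat)
    (F : 'rV[R]_n -> 'rV[R]_m) (U : set 'rV[R]_n) (u0 : 'rV[R]_n) :
  open U -> Ck 1 F U -> U u0 -> injective ('d F u0) ->
  exists2 eps : R, 0 < eps & exists2 d : R, 0 < d &
    forall u v E, `|u - u0| <= d -> `|v - u0| <= d -> tangent_frame F u E ->
      eps * `|u - v| ^+ 2 <= \sum_i dot (F u - F v) (E i) ^+ 2.
Proof.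
move=> openU F_C1 Uu0 Finj.
have [c c_gt0 cF] := injective_diff_lower_bound Finj.
(* k absorbs the factor m between the sup norm and the inner product *)
pose k : R := 4 * m.+1%:R; have k_gt0 : 0 < k by rewrite mulr_gt0.
pose e := c / k / n.+1%:R.
have e_gt0 : 0 < e by rewrite !divr_gt0.
have [d d_gt0 dP] := C1_strictly_differentiable openU F_C1 Uu0 e_gt0.
exists (c ^+ 2 / 16); first by rewrite divr_gt0// exprn_gt0.
exists d => // u v E ud vd [E_on Espan].
have [Uu Du uP] := dP u ud; have [Uv Dv vP] := dP v vd.
have diffE x : U x -> forall z, 'd F x z = \sum_i z 0 i *: 'D_(delta_mx 0 i) F x.
  by move=> Ux z; rewrite diff_sum_partial//; exact: C1_differentiable F_C1 _ _.
(* xi is the increment and w its tangential approximation *)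
set x := u - v; set xi := F u - F v; pose w := 'd F u x.
have ne : n.+1%:R * e = c / k by rewrite mulrC divfK// pnatr_eq0.
have wA : `|w - 'd F u0 x| <= n%:R * e * `|x|.
  pose a i : 'rV[R]_m := 'D_(delta_mx 0 i) F u - 'D_(delta_mx 0 i) F u0.
  have -> : w - 'd F u0 x = \sum_i x 0 i *: a i.
    under eq_bigr => i _ do rewrite scalerBr.
    rewrite sumrB; congr (_ - _); [exact: (diffE u Uu)|].
    exact: (diffE u0 Uu0).
  by apply: norm_sum_coord_le => i; exact: Du.
have xiA : `|xi - 'd F u0 x| <= e * `|x| by rewrite (diffE u0 Uu0); exact: vP ud.
have xiw : `|xi - w| <= c / k * `|x|.
  have -> : xi - w = (xi - 'd F u0 x) - (w - 'd F u0 x).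
    by rewrite opprB addrA subrK.
  apply: le_trans (ler_normB _ _) _; rewrite -ne -natr1 mulrDl mul1r mulrDl.
  by rewrite addrC lerD.
have w_ge : c / 2 * `|x| <= `|w|.
  have nek : n%:R * e <= c / 2.
    apply: (@le_trans _ _ (c / k)); first by rewrite -ne ler_wpM2r ?ler_nat ?ltW.
    by rewrite ler_wpM2l ?(ltW c_gt0)// lef_pV2 ?posrE// /k -natrM ler_nat mulnS.
  have := ler_normB w (w - 'd F u0 x); rewrite subKr => Aw.
  have wAx : `|w - 'd F u0 x| <= c / 2 * `|x|.
    exact: le_trans wA (ler_wpM2r (normr_ge0 x) nek).
  have : c * `|x| <= `|w| + c / 2 * `|x|.
    exact: le_trans (cF x) (le_trans Aw (lerD (lexx _) wAx)).
  by rewrite -lerBlDr -mulrBl [X in X * _](_ : _ = c / 2)//; field.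
have ww_ge : c ^+ 2 / 4 * `|x| ^+ 2 <= dot w w.
  apply: le_trans (norm_le_dot _).
  have -> : c ^+ 2 / 4 * `|x| ^+ 2 = (c / 2 * `|x|) ^+ 2 by field.
  by rewrite lerXn2r// nnegrE// mulr_ge0// divr_ge0// ltW.
have xiw2 : dot (xi - w) (xi - w) <= dot w w / 4.
  apply: le_trans (dot_le_norm _) _.
  have h1 : `|xi - w| ^+ 2 <= (c / k * `|x|) ^+ 2.
    by rewrite lerXn2r// nnegrE// mulr_ge0// divr_ge0// ltW.
  have h2 : m%:R * (c / k) ^+ 2 <= c ^+ 2 / 16.
    rewrite expr_div_n mulrCA; apply: ler_wpM2l; first by rewrite sqr_ge0.
    rewrite ler_pdivrMr ?exprn_gt0// mulrC /k exprMn.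
    have -> : (16 : R)^-1 = (4 ^+ 2)^-1 by congr (_^-1); ring.
    rewrite mulrAC mulfV ?mul1r ?expf_neq0 ?pnatr_eq0//.
    by rewrite -natrX ler_nat expnS expn1 mulSn (leq_trans _ (leq_addr _ _)).
  apply: le_trans (ler_wpM2l (ler0n _ _) h1) _.
  rewrite exprMn mulrA; apply: le_trans (ler_wpM2r (sqr_ge0 _) h2) _.
  by move: (dot w w) ww_ge => p; move: (`|x|) => q; clear; lra.
have xi_w : dot w w / 2 <= dot xi w.
  have := dot_ge0 ((xi - w) + 2^-1 *: w).
  have -> : dot xi w = dot (xi - w) w + dot w w by rewrite -dotDl subrK.
  move: (w) (xi - w) xiw2 => y z.
  rewrite !(dotDl, dotDr, dotZl, dotZr) (dotC y z).
  by move: (dot z z) (dot z y) (dot y y) => p q r; clear; lra.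
have [cc wE] := Espan x; have S := sqr_dot_span_le E_on xi wE.
have [x0|x_neq0] := eqVneq `|x| 0.
  by rewrite x0 expr0n/= mulr0; apply: sumr_ge0 => i _; exact: sqr_ge0.
have ww_gt0 : 0 < dot w w.
  apply: lt_le_trans ww_ge; rewrite mulr_gt0 ?divr_gt0 ?exprn_gt0//.
  by rewrite lt_neqAle eq_sym x_neq0 normr_ge0.
rewrite -(ler_pM2l ww_gt0); apply: le_trans S.
apply: (@le_trans _ _ ((dot w w / 2) ^+ 2)); last first.
  rewrite lerXn2r// nnegrE ?divr_ge0 ?(ltW ww_gt0)// (le_trans _ xi_w)//.
  by rewrite divr_ge0// ltW.
rewrite expr_div_n expr2 -[X in _ <= X]mulrA ler_pM2l//.
by move: (dot w w) ww_ge => p; move: (`|x|) => q; clear; lra.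
Qed.

Lemma near_lt (R : realType) (T : topologicalType) (f : T -> R) x c :
  {for x, continuous f} -> f x < c -> \forall y \near x, f y < c.
Proof. by move=> fx; exact: (cvgr_lt (f x) fx). Qed.

Lemma near_gt (R : realType) (T : topologicalType) (f : T -> R) x c :
  {for x, continuous f} -> c < f x -> \forall y \near x, c < f y.
Proof. by move=> fx; exact: (cvgr_gt (f x) fx). Qed.

Lemma has_hessian_continuous (R : realType) (m : nat) (G : 'rV[R]_m -> R) dG HG :
  has_hessian G dG HG -> continuous G.
Proof. by move=> [Gd _] x; apply: differentiable_continuous; have [] := Gd x. Qed.

Lemma continuous_center (R : realType) (m : nat) (b : 'rV[R]_m) :
  continuous (fun x : 'rV[R]_m => x - b).
Proof.
move=> x.
exact: (@cvgB _ _ _ (nbhs x) _ (fun y => y) (cst b) _ _ cvg_id (cvg_cst b)).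
Qed.

Lemma continuous_sqdist (R : realType) (m : nat) (b : 'rV[R]_m) :
  continuous (fun x : 'rV[R]_m => dot (x - b) (x - b)).
Proof. exact: has_hessian_continuous (has_hessian_sqdist b). Qed.

Lemma continuous_norm_center (R : realType) (m : nat) (b : 'rV[R]_m) :
  continuous (fun x : 'rV[R]_m => `|x - b|).
Proof. by move=> x; exact: (cvg_norm (@continuous_center _ _ b x)). Qed.

Lemma closed_ball_compact_rV (R : realType) (n : nat) (u : 'rV[R]_n) (d : R) :
  compact [set x | `|x - u| <= d].
Proof.
apply: bounded_closed_compact.
  exists (d + `|u|); split; first exact: num_real.
  move=> M dM x /= xd; apply: ltW; apply: le_lt_trans dM.
  rewrite -[x in `|x|](subrK u); apply: le_trans (ler_normD _ _) _.
  by rewrite lerD2r.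
exact: (closed_comp (D := [set t | t <= d]) 
  (fun x _ => @continuous_norm_center _ _ u x) (@closed_le _ d)).
Qed.

Lemma compact_argmin (R : realType) (T : topologicalType) (K : set T)
    (f : T -> R) p :
  compact K -> K p -> (forall x, K x -> {for x, continuous f}) ->
  exists2 q, K q & forall x, K x -> f q <= f x.
Proof.
move=> cK Kp cf.
have [|q] := @compact_EVT_min _ _ f _ (ex_intro _ p Kp) cK.
  by apply: continuous_in_subspaceT => x; rewrite inE; exact: cf.
by rewrite inE => Kq qmin; exists q => // x Kx; apply: qmin; rewrite inE.
Qed.

Section StrongMaximumPrinciple.
Variables (R : realType) (n m : nat) (F : 'rV[R]_n -> 'rV[R]_m).
Variables (U : set 'rV[R]_n) (u0 : 'rV[R]_n).
Hypotheses (openU : open U) (F_C1 : Ck 1 F U) (Uu0 : U u0).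
Hypothesis F_injective : injective ('d F u0).
Hypothesis frames : forall u, U u ->
  exists2 E, tangent_frame F u E & second_order_testable F u E.

Variables (G : 'rV[R]_m -> R) (dG : 'rV[R]_m -> 'rV[R]_m).
Variable HG : 'rV[R]_m -> 'rV[R]_m -> 'rV[R]_m.
Hypothesis G_test : has_hessian G dG HG.
Hypothesis G_min : \forall u \near u0, G (F u0) <= G (F u).
Hypothesis G_super : \forall u \near u0, forall E, tangent_frame F u E ->
  drift E (F u) (dG (F u)) (HG (F u)) <= 0.

Let F_cont u : U u -> {for u, continuous F}.
Proof.
by move=> Uu; apply/differentiable_continuous/(C1_differentiable openU F_C1).
Qed.

(** Suppose G (F v) > G (F u0) for some v close to u0, and let y = F v.  Subtract
    from G a small multiple e of a Gaussian centered at y and minimize on a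
    closed ball K around u0.  The minimum is smaller than G (F u0) because the
    Gaussian is larger at F u0 than on the boundary of K; it is not near v, where
    G exceeds G (F u0) by more than e.  So it is at an interior point w where
    F w - y has a definite tangential part, and there the second order test
    contradicts the sign of the drift Laplacian. *)
Lemma strong_maximum_principle : \forall u \near u0, G (F u) = G (F u0).
Proof.
have arith1 (a b c t : R) : a - b <= t - c -> t <= a -> b < c -> False by lra.
have arith2 (a b c t z : R) :
  a - b <= t - c -> b <= z -> 0 < c -> t + z < a -> False by lra.
have arith3 (a b c z : R) : c + z + 1 <= b -> - z <= a -> 0 < b - c + a by lra.
have [eps eps_gt0 [d1 d1_gt0 tangential]] :=
  tangential_increment_lower_bound openU F_C1 Uu0 F_injective.
have [d d_gt0 dP] : exists2 d : R, 0 < d & forall u, `|u - u0| <= d ->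
    [/\ U u, `|u - u0| <= d1, G (F u0) <= G (F u) &
      forall E, tangent_frame F u E -> drift E (F u) (dG (F u)) (HG (F u)) <= 0].
  have nU : \forall u \near u0, U u by exact: open_nbhs_nbhs.
  have : \forall u \near u0, [/\ U u, G (F u0) <= G (F u) &
      forall E, tangent_frame F u E -> drift E (F u) (dG (F u)) (HG (F u)) <= 0].
    by apply: filterS3 nU G_min G_super => u.
  move=> /nbhs_ballP[r /= r_gt0 rP].
  exists (Num.min (r / 2) d1); first by rewrite lt_min divr_gt0.
  move=> u; rewrite le_min => /andP[ur ud].
  have [|? ? ?] := rP u; last by split.
  rewrite -ball_normE/= distrC; apply: le_lt_trans ur _.
  by rewrite ltr_pdivrMr// ltr_pMr// ltr1n.
(* tau bounds from below the squared distance of F v, for |v - u0| <= d / 2,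
   to the image of the boundary of the ball of radius d *)
pose tau := eps * (d / 2) ^+ 2.
have tau_gt0 : 0 < tau by rewrite mulr_gt0// exprn_gt0// divr_gt0.
have near_v : \forall v \near u0, `|v - u0| <= d / 2 /\
    dot (F v - F u0) (F v - F u0) < tau.
  have near_d : \forall v \near u0, `|v - u0| <= d / 2.
    have : \forall v \near u0, `|v - u0| < d / 2.
      apply: near_lt; first exact: continuous_norm_center.
      by rewrite subrr normr0 divr_gt0.
    by apply: filterS => v /ltW.
  have near_tau : \forall v \near u0, dot (F v - F u0) (F v - F u0) < tau.
    have : {for u0, continuous ((fun x => dot (x - F u0) (x - F u0)) \o F)}.
      by apply: continuous_comp; [exact: F_cont|exact: continuous_sqdist].
    by move=> /near_lt; apply; rewrite /= subrr dot0l.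
  by apply: filterS2 near_d near_tau => v.
apply: filterS near_v => v [vd v_tau].
have [Uv vd1 v_ge _] : [/\ U v, `|v - u0| <= d1, G (F u0) <= G (F v) &
      forall E, tangent_frame F v E -> drift E (F v) (dG (F v)) (HG (F v)) <= 0].
  by apply: dP; apply: le_trans vd _; rewrite ler_pdivrMr// ler_pMr// ler1n.
apply/eqP; rewrite eq_le v_ge andbT leNgt; apply/negP => v_gt.
pose y := F v; pose mu := G (F u0).
pose e := (G (F v) - mu) / 2.
have e_gt0 : 0 < e by rewrite divr_gt0// subr_gt0.
have [s s_gt0 sP] : exists2 s : R, 0 < s &
    forall u, `|u - v| < s -> mu + e < G (F u).
  have : {for v, continuous (G \o F)}.
    apply: continuous_comp; first exact: F_cont.
    exact: (has_hessian_continuous G_test).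
  have mue : mu + e < G (F v).
    by rewrite -ltrBrDl /e ltr_pdivrMr// ltr_pMr ?subr_gt0// ltr1n.
  move=> /near_gt/(_ mue)/nbhs_ballP[s /= s_gt0 sP]; exists s => // u us.
  by apply: sP; rewrite -ball_normE/= distrC.
pose K := [set u : 'rV[R]_n | `|u - u0| <= d].
have Ku0 : K u0 by rewrite /K/= subrr normr0 ltW.
have [M M_ge0 MP] : exists2 M : R, 0 <= M &
    forall u, K u -> - M <= dot (F u - y) (F u).
  have dotFE z : dot (z - y) z = dot (z - 0) (z - 0) + (dot (- y) z + 0).
    by rewrite subr0 addr0 dotDl.
  have cont_dot : continuous (fun z : 'rV[R]_m => dot (z - y) z).
    have -> : (fun z => dot (z - y) z) =
        (fun z => dot (z - 0) (z - 0) + (dot (- y) z + 0)).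
      by apply/funext => z; exact: dotFE.
    exact: (has_hessian_continuous
      (has_hessianD (has_hessian_sqdist 0) (has_hessian_affine (- y) 0))).
  have [|q Kq qmin] := @compact_argmin _ _ K ((fun z => dot (z - y) z) \o F) u0
    (@closed_ball_compact_rV _ _ u0 d) Ku0.
    move=> u /dP[Uu _ _ _]; apply: continuous_comp; first exact: F_cont.
    exact: cont_dot.
  exists `|dot (F q - y) (F q)| => // u Ku.
  by apply: le_trans (qmin u Ku); rewrite lerNl -normrN ler_norm.
(* eps * s ^ 2 bounds the squared tangential part outside the ball of radius s
   around v, so this al gives the Gaussian a positive drift Laplacian there *)
pose al := (2 * n%:R + M + 1) / (4 * eps * s ^+ 2).
have al_gt0 : 0 < al.
  rewrite divr_gt0 ?mulr_gt0 ?exprn_gt0//.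
  by rewrite ltr_wpDl// addr_ge0// mulr_ge0.
have al4_gt0 : 0 < 4 * al by rewrite pmulr_rgt0.
have alE : 4 * al * (eps * s ^+ 2) = 2 * n%:R + M + 1.
  by rewrite /al; field; rewrite !gt_eqF.
pose Phi x := G x + - e * gaussian al y x.
have Phi_test :=
  has_hessianD G_test (has_hessianZ (- e) (has_hessian_gaussian al y)).
have [w Kw wmin] : exists2 w, K w & forall u, K u -> Phi (F w) <= Phi (F u).
  apply: (compact_argmin (f := Phi \o F) (@closed_ball_compact_rV _ _ u0 d) Ku0).
  move=> u /dP[Uu _ _ _]; apply: continuous_comp; first exact: F_cont.
  exact: (has_hessian_continuous Phi_test).
have [Uw wd1 w_ge w_super] := dP w Kw.
have [E E_frame E_test] := frames Uw.
have := tangential w v E wd1 vd1 E_frame; rewrite -/y => w_tan.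
have w_u0 : G (F w) - e * gaussian al y (F w) <= mu - e * gaussian al y (F u0).
  by have := wmin u0 Ku0; rewrite /Phi !mulNr.
have gaussian_gt0 x : 0 < gaussian al y x by exact: expR_gt0.
have gaussian_le1 x : gaussian al y x <= 1.
  by rewrite -expR0 ler_expR mulNr oppr_le0 mulr_ge0 ?dot_ge0// ltW.
have w_int : `|w - u0| < d.
  rewrite lt_neqAle Kw andbT; apply/eqP => wd.
  have wv : d / 2 <= `|w - v|.
    have := ler_distD v w u0; rewrite wd => /le_trans/(_ (lerD (lexx _) vd)).
    by rewrite -lerBlDr [X in X <= _](_ : _ = d / 2)//; field.
  have tau_w : tau <= dot (F w - y) (F w - y).
    apply: le_trans (Bessel E_frame.1 _); apply: le_trans w_tan.
    by rewrite ler_pM2l// lerXn2r// nnegrE// divr_ge0// ltW.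
  have lt_g : e * gaussian al y (F w) < e * gaussian al y (F u0).
    rewrite ltr_pM2l// ltr_expR ltr_nM2l ?oppr_lt0//; apply: lt_le_trans tau_w.
    by rewrite -opprB dotNl dotNr opprK.
  exact: arith1 w_u0 w_ge lt_g.
have w_far : s <= `|w - v|.
  rewrite leNgt; apply/negP => /sP Gw.
  have le_e : e * gaussian al y (F w) <= e by rewrite ger_pMr.
  have gt0 : 0 < e * gaussian al y (F u0) by rewrite mulr_gt0.
  exact: arith2 w_u0 le_e gt0 Gw.
have near_w : \forall u \near w, Phi (F w) <= Phi (F u).
  have : \forall u \near w, `|u - u0| < d.
    by apply: near_lt => //; exact: continuous_norm_center.
  by apply: filterS => u /ltW; exact: wmin.
have [_] := E_test _ _ _ Phi_test near_w.
rewrite driftD driftZ drift_gaussian; last exact: E_frame.1.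
rewrite leNgt => /negP; apply.
rewrite -[ltRHS]addr0; apply: ler_ltD; first exact: w_super.
rewrite mulNr oppr_lt0 -[X in _ * X]mulrA.
rewrite (pmulr_rgt0 _ e_gt0) (pmulr_rgt0 _ al_gt0).
rewrite (pmulr_rgt0 _ (gaussian_gt0 _)).
have coeff : 2 * n%:R + M + 1 <= 4 * al * \sum_i dot (F w - y) (E i) ^+ 2.
  rewrite -alE (ler_pM2l al4_gt0); apply: le_trans w_tan.
  by rewrite ler_pM2l// lerXn2r// nnegrE// ltW.
exact: arith3 coeff (MP w Kw).
Qed.

End StrongMaximumPrinciple.

(** * Self-shrinkers as immersed manifolds *)

Section Shrinker.
Variables (R : realType) (m n : nat) (S : manifold R n) (X : S -> 'rV[R]_m).
Hypothesis X_shrinker : self_shrinker X.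

Lemma shrinker_frames (c : chart R n S) u : atlas c -> cod c u ->
  exists2 E, tangent_frame (X \o param c) u E &
             second_order_testable (X \o param c) u E.
Proof.
move=> Ac cu; have [X_imm X_H] := X_shrinker.
have [F_smooth _] := X_imm c Ac; have H := X_H c Ac u cu.
exact: (second_order_test (@cod_open _ _ _ c) F_smooth cu H).
Qed.

Lemma shrinker_continuous : continuous X.
Proof.
move=> p; have [c Ac cp] := atlas_cover p.
have cu := coord_cod cp.
have Fu : {for Defs.coord c p, continuous (X \o param c)}.
  have [cF _] := (X_shrinker.1 c Ac).1 0%N; exact: cF.
have Fp : {for p, continuous ((X \o param c) \o Defs.coord c)}.
  apply: continuous_comp; last exact: Fu.
  exact: (Defs.coord_continuous cp).
have near_dom : \forall q \near p, dom c q.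
  by apply: open_nbhs_nbhs; split => //; exact: dom_open.
move=> P XP; have /Fp near_P : nbhs (((X \o param c) \o Defs.coord c) p) P.
  by rewrite /= (Defs.coordK cp).
apply: filterS2 near_dom near_P => q cq; by rewrite /= (Defs.coordK cq).
Qed.

Lemma near_param (c : chart R n S) (p : S) (P : set S) :
  dom c p -> (\forall q \near p, P q) ->
  \forall u \near Defs.coord c p, P (param c u).
Proof.
move=> cp Pp; apply: (param_continuous (coord_cod cp)).
by rewrite Defs.coordK.
Qed.

Lemma near_coord (c : chart R n S) (p : S) (Q : set 'rV[R]_n) : dom c p ->
  (\forall u \near Defs.coord c p, Q u) -> \forall q \near p, Q (Defs.coord c q).
Proof. by move=> cp Qu; exact: (Defs.coord_continuous cp). Qed.

Lemma shrinker_test p : exists E : 'I_n -> 'rV[R]_m,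
  orthonormal_family E /\
  forall G dG HG, has_hessian G dG HG -> (\forall q \near p, G (X p) <= G (X q)) ->
    (forall i, dot (dG (X p)) (E i) = 0) /\
    0 <= drift E (X p) (dG (X p)) (HG (X p)).
Proof.
have [c Ac cp] := atlas_cover p.
have [E [E_on _] E_test] := shrinker_frames Ac (coord_cod cp).
exists E; split=> [//|] G dG HG Gtest Gmin.
have := E_test G dG HG Gtest; rewrite /= Defs.coordK//; apply.
exact: near_param cp Gmin.
Qed.

Lemma shrinker_strong_max p G dG HG : has_hessian G dG HG ->
  (\forall q \near p, G (X p) <= G (X q)) ->
  (\forall q \near p, forall E : 'I_n -> 'rV[R]_m,
     orthonormal_family E ->
     drift E (X q) (dG (X q)) (HG (X q)) <= 0) ->
  \forall q \near p, G (X q) = G (X p).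
Proof.
move=> Gtest Gmin Gsuper; have [c Ac cp] := atlas_cover p.
have cu := coord_cod cp.
have [F_smooth F_inj] := X_shrinker.1 c Ac.
have const : \forall u \near Defs.coord c p,
    G ((X \o param c) u) = G ((X \o param c) (Defs.coord c p)).
  apply: (strong_maximum_principle (@cod_open _ _ _ c) (F_smooth 1%N) cu
    (F_inj _ cu)
    (fun u => @shrinker_frames c u Ac) Gtest).
  - by rewrite /= Defs.coordK//; exact: near_param cp Gmin.
  - have := near_param cp Gsuper; apply: filterS => u h E [E_on _].
    exact: h.
have near_dom : \forall q \near p, dom c q.
  by apply: open_nbhs_nbhs; split => //; exact: dom_open.
apply: filterS2 near_dom (near_coord cp const) => q cq.
by rewrite /= !Defs.coordK.
Qed.

(** Charts make the manifold locally path connected: a segment in the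
    coordinates stays in the component of its origin. *)
Lemma open_component p : open (connected_component [set: S] p).
Proof.
rewrite openE => q pq; rewrite /interior.
have [c Ac cq] := atlas_cover q; have cu := coord_cod cq.
have /nbhs_ballP[r /= r_gt0 rP] : nbhs (Defs.coord c q) (cod c).
  by apply: open_nbhs_nbhs; split => //; exact: (@cod_open _ _ _ c).
set u := Defs.coord c q in cu r_gt0 rP.
have near_r : \forall x \near q, `|Defs.coord c x - u| < r.
  apply: (@near_coord c q (fun v => `|v - u| < r)) => //.
  by apply: near_lt; [exact: continuous_norm_center|rewrite subrr normr0].
have near_dom : \forall x \near q, dom c x.
  by apply: open_nbhs_nbhs; split => //; exact: dom_open.
apply: filterS2 near_dom near_r => x cx xr.
(* the image in S of the segment joining the coordinates of q and x *)
pose g (t : R) : S := param c (u + t *: (Defs.coord c x - u)).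
have g_cod t : t \in `[0, 1] -> cod c (u + t *: (Defs.coord c x - u)).
  rewrite in_itv/= => /andP[t0 t1]; apply: rP.
  rewrite -ball_normE/= opprD addrA subrr sub0r normrN normrZ ger0_norm//.
  by apply: le_lt_trans xr; rewrite ler_piMl.
have g_conn : connected (g @` `[0, 1]).
  apply: connected_continuous_connected; first exact: segment_connected.
  apply: continuous_in_subspaceT => t; rewrite inE => t01.
  apply: (@continuous_comp _ _ _
    (fun t : R => u + t *: (Defs.coord c x - u)) (param c)).
    apply: cvgD; first exact: cvg_cst.
    by apply: cvgZr_tmp; exact: cvg_id.
  exact: param_continuous (g_cod t t01).
apply: connected_component_trans pq _.
exists (g @` `[0, 1]).
  split=> //; exists 0; first by rewrite /= in_itv/= lexx ler01.
  by rewrite /g scale0r addr0 /u Defs.coordK.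
exists 1; first by rewrite /= in_itv/= lexx ler01.
by rewrite /g scale1r addrC subrK Defs.coordK.
Qed.

(** By the strong maximum principle the set of minimum points is open; it is
    closed by continuity, and the component is connected. *)
Lemma superharmonic_constant p q G dG HG : has_hessian G dG HG ->
  (forall x (E : 'I_n -> 'rV[R]_m), orthonormal_family E ->
     drift E (X x) (dG (X x)) (HG (X x)) <= 0) ->
  connected_component [set: S] p q ->
  (forall x, connected_component [set: S] p x -> G (X q) <= G (X x)) ->
  forall x, connected_component [set: S] p x -> G (X x) = G (X q).
Proof.
move=> Gtest Gsuper pq qmin; set C := connected_component _ _ in pq qmin *.
have GX_cont : continuous (G \o X).
  move=> x; apply: continuous_comp; first exact: shrinker_continuous.
  exact: (has_hessian_continuous Gtest).
pose Z := C `&` [set x | G (X x) = G (X q)].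
have Z_open : open Z.
  rewrite openE => x [Cx xq]; rewrite /interior.
  have near_C : \forall y \near x, C y.
    by apply: open_nbhs_nbhs; split => //; exact: open_component.
  have near_Z : \forall y \near x, G (X y) = G (X x).
    apply: (shrinker_strong_max Gtest); last by apply: nearW => y; exact: Gsuper.
    by apply: filterS near_C => y Cy; rewrite xq qmin.
  by apply: filterS2 near_C near_Z => y Cy yx; split; rewrite //= yx.
have Z_closed : closed [set x | G (X x) = G (X q)].
  exact: (preimage_closed (D := [set t | t = G (X q)]) (fun x _ => GX_cont x)
    (@closed_eq _ (G (X q)))).
have ZC : Z = C.
  apply: (@component_connected _ [set: S] p).
  - by exists q.
  - by exists Z => //; rewrite /Z setIA setIid.
  - by exists [set x | G (X x) = G (X q)].
by move=> x; rewrite -ZC => -[].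
Qed.

Hypothesis X_proper : proper_map X.

Lemma sqball_compact (b : 'rV[R]_m) (k : R) :
  compact [set x | dot (x - b) (x - b) <= k].
Proof.
have arith (z : R) :
  0 <= z -> 0 <= z ^+ 2 - z *+ 2 + 1 -> z ^+ 2 <= k -> z <= k + 1.
  by lra.
apply: (@subclosed_compact _ _ [set x | `|x - b| <= k + 1]).
- exact: (preimage_closed (D := [set t | t <= k])
    (fun x _ => @continuous_sqdist _ _ b x) (@closed_le _ k)).
- exact: closed_ball_compact_rV.
- move=> x /= xk; have := le_trans (norm_le_dot (x - b)) xk.
  have := sqr_ge0 (`|x - b| - 1); rewrite sqrrB1.
  exact: arith (normr_ge0 _).
Qed.

(** The bound makes the sublevel set of the minimization relatively compact; it
    holds either because G is coercive or because the image of C is bounded, and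
    both cases occur. *)
Lemma proper_argmin (C : set S) (p : S) (G : 'rV[R]_m -> R) (b : 'rV[R]_m) (k : R) :
  continuous G -> closed C -> C p ->
  (forall x, C x -> G (X x) <= G (X p) -> dot (X x - b) (X x - b) <= k) ->
  exists2 q, C q & forall x, C x -> G (X q) <= G (X x).
Proof.
move=> Gcont C_closed Cp Cbound.
have cK := compact_closedI (X_proper (@sqball_compact b k)) C_closed.
have Kp : (X @^-1` [set x | dot (x - b) (x - b) <= k] `&` C) p.
  by split => //=; exact: Cbound.
have [x _|q [_ Cq] qmin] := @compact_argmin _ _ _ (G \o X) p cK Kp.
  by apply: continuous_comp; [exact: shrinker_continuous|exact: Gcont].
exists q => // x Cx; have [Gx|/ltW Gx] := leP (G (X x)) (G (X p)).
  by apply: qmin; split => //=; exact: Cbound.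
by apply: le_trans Gx; exact: qmin.
Qed.

End Shrinker.

(** * Position with respect to spheres *)

Section Spheres.
Variables (R : realType) (m : nat).
Implicit Types (a x : 'rV[R]_m) (r : R).

Lemma esphereE a x r : 0 <= r ->
  esphere a (Num.sqrt r) x <-> dot (x - a) (x - a) = r.
Proof.
move=> r_ge0; rewrite /esphere/= /enorm; split=> [h|->//].
by rewrite -[LHS]sqr_sqrtr ?dot_ge0// h sqr_sqrtr.
Qed.

Lemma eballE a x r : eball a (Num.sqrt r) x <-> dot (x - a) (x - a) < r.
Proof.
rewrite /eball/= /enorm; split=> [|h]; last first.
  by rewrite ltr_sqrt// (le_lt_trans (dot_ge0 _) h).
have [r_gt0|r_le0] := ltP 0 r; first by rewrite ltr_sqrt.
by rewrite (ler0_sqrtr r_le0) ltNge sqrtr_ge0.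
Qed.

(** Only this inclusion is claimed: for r = 0 the ball is empty. *)
Lemma closure_eball_sub a x r :
  closure (eball a (Num.sqrt r)) x -> dot (x - a) (x - a) <= r.
Proof.
have cl : closed [set y | dot (y - a) (y - a) <= r].
  exact: (preimage_closed (D := [set t | t <= r])
    (fun y _ => @continuous_sqdist _ _ a y) (@closed_le _ r)).
have sub : eball a (Num.sqrt r) `<=` [set y | dot (y - a) (y - a) <= r].
  by move=> y /eballE; exact: ltW.
by move=> /(closureS sub); rewrite -((closure_id _).1 cl).
Qed.

(** The power of x with respect to the sphere of center a and squared radius
    2n + |a|^2, in the form in which the drift Laplacian of |x - 2a|^2 produces
    it; [sphere_powerE] gives the usual form. *)
Definition sphere_power (n : nat) a x : R := dot (x - 2 *: a) x - 2 * n%:R.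

Lemma sphere_powerE n a x :
  sphere_power n a x = dot (x - a) (x - a) - (2 * n%:R + enorm a ^+ 2).
Proof.
rewrite /sphere_power sqr_enorm !(dotBl, dotBr, dotZl, dotZr) (dotC x a).
by ring.
Qed.

Lemma esphere_power n a x :
  esphere a (Num.sqrt (2 * n%:R + enorm a ^+ 2)) x <-> sphere_power n a x = 0.
Proof.
have r_ge0 : 0 <= 2 * n%:R + enorm a ^+ 2.
  by apply: addr_ge0; [exact: mulr_ge0|exact: sqr_ge0].
apply: iff_trans (esphereE a x r_ge0) _.
rewrite sphere_powerE; split=> [->|/eqP]; first exact: subrr.
by rewrite subr_eq0 => /eqP.
Qed.

End Spheres.

Section ShrinkerAndSpheres.
Variables (R : realType) (m n : nat) (S : manifold R n) (X : S -> 'rV[R]_m).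
Hypotheses (X_shrinker : self_shrinker X) (X_proper : proper_map X).

(** The sign sg is 1 for a surface outside the sphere and -1 for a surface inside,
    so that in both cases the function is superharmonic and is minimized. *)
Definition comparison (sg : R) (a : 'rV[R]_m) x :=
  sg * dot (x - 2 *: a) (x - 2 *: a).

Lemma has_hessian_comparison sg a : has_hessian (comparison sg a)
  (fun x => sg *: (2 *: (x - 2 *: a))) (fun _ v => sg *: (2 *: v)).
Proof. exact: (has_hessianZ sg (has_hessian_sqdist (2 *: a))). Qed.

Lemma drift_comparison sg a (E : 'I_n -> 'rV[R]_m) x :
  orthonormal_family E ->
  drift E x (sg *: (2 *: (x - 2 *: a))) (fun v => sg *: (2 *: v)) =
  - (sg * sphere_power n a x).
Proof.
by move=> E_on; rewrite driftZ drift_sqdist// /sphere_power -mulrN opprB.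
Qed.

(** Outside, |x - 2a|^2 is coercive; inside, C has bounded image. *)
Lemma comparison_argmin (sg : R) a (C : set S) p : sg = 1 \/ sg = -1 ->
  closed C -> C p -> (forall x, C x -> 0 <= sg * sphere_power n a (X x)) ->
  exists2 q, C q & forall x, C x -> comparison sg a (X q) <= comparison sg a (X x).
Proof.
move=> sgE C_closed Cp Cside.
have cont := has_hessian_continuous (has_hessian_comparison sg a).
case: sgE => sgE.
- apply: (proper_argmin X_shrinker X_proper (b := 2 *: a)
    (k := comparison sg a (X p)) cont C_closed Cp) => x _.
  by rewrite /comparison sgE !mul1r.
- apply: (proper_argmin X_shrinker X_proper (b := a)
    (k := 2 * n%:R + enorm a ^+ 2) cont C_closed Cp) => x Cx _.
  have := Cside x Cx.
  by rewrite sgE mulN1r oppr_ge0 sphere_powerE subr_le0.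
Qed.

Lemma continuous_sphere_power a : continuous (fun x => sphere_power n a (X x)).
Proof.
have cont : continuous (sphere_power n a).
  have -> : sphere_power n a = (fun x : 'rV[R]_m =>
      dot (x - a) (x - a) + (dot 0 x - (2 * n%:R + enorm a ^+ 2))).
    by apply/funext => x; rewrite sphere_powerE dot0l sub0r.
  exact: (has_hessian_continuous (has_hessianD (has_hessian_sqdist a)
    (has_hessian_affine 0 (- (2 * n%:R + enorm a ^+ 2))))).
move=> p; apply: continuous_comp; last exact: cont.
exact: shrinker_continuous.
Qed.

(** Without zeros, the set C where the power has a given strict sign is both
    closed and open, so that the minimum of the comparison function on C is a
    local minimum on the whole surface. *)
Lemma sphere_power_vanishes a : [set: S] !=set0 ->
  exists p, sphere_power n a (X p) = 0.
Proof.
move=> [p _]; apply: contrapT => no_zero.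
have neq0 x : sphere_power n a (X x) != 0.
  by apply/eqP => x0; apply: no_zero; exists x.
have [sg sgE p_pos] : exists2 sg : R,
    sg = 1 \/ sg = -1 & 0 < sg * sphere_power n a (X p).
  have [pp|pn] := ltP 0 (sphere_power n a (X p)).
    by exists 1; [left|rewrite mul1r].
  by exists (-1); [right|rewrite mulN1r oppr_gt0 lt_neqAle neq0].
pose side x := sg * sphere_power n a (X x).
have side_cont : continuous side.
  by move=> x; apply: cvgM; [exact: cvg_cst|exact: continuous_sphere_power].
have side_neq0 x : side x != 0.
  by rewrite mulf_neq0//; case: sgE => ->; rewrite ?oppr_eq0 oner_eq0.
pose C := [set x | 0 <= side x].
have C_closed : closed C.
  apply: (@preimage_closed _ _ side [set t | 0 <= t]); last exact: closed_ge.
  by move=> x _; exact: side_cont.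
have C_pos x : C x -> 0 < side x.
  by rewrite /C/= le_eqVlt eq_sym (negPf (side_neq0 x)).
have [q Cq qmin] := comparison_argmin sgE C_closed (ltW p_pos) (fun x Cx => Cx).
have near_C : \forall x \near q, C x.
  have := near_gt (side_cont q) (C_pos q Cq).
  by apply: filterS => x; exact: ltW.
have [E [E_on E_test]] := shrinker_test X_shrinker q.
have [|_] := E_test _ _ _ (has_hessian_comparison sg a).
  by apply: filterS near_C.
rewrite drift_comparison// oppr_ge0 leNgt => /negP; apply.
exact: C_pos.
Qed.

(** The norm of X comes for free: the power and |X - 2a|^2 being constant, so is
    <a, X>, which is an eigenfunction of the drift Laplacian for the nonzero
    eigenvalue - 1/2 and thus vanishes. *)
Lemma one_sided_on_sphere (sg : R) a : sg = 1 \/ sg = -1 ->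
  (forall x, 0 <= sg * sphere_power n a (X x)) ->
  forall p, sphere_power n a (X p) = 0 /\ dot (X p) (X p) = 2 * n%:R.
Proof.
move=> sgE one_side p; pose C := connected_component [set: S] p.
have Cp : C p by exact: connected_component_refl.
have C_closed : closed C by apply: component_closed; exact: closedT.
have [q Cq qmin] := comparison_argmin sgE C_closed
  Cp (fun x _ => one_side x).
have const :=
  superharmonic_constant X_shrinker (has_hessian_comparison sg a) _ Cq qmin.
have {}const x : C x -> comparison sg a (X x) = comparison sg a (X p).
  move=> Cx; rewrite const ?const// => y E E_on;
    by rewrite drift_comparison// oppr_le0.
have near_C x : C x -> \forall y \near x, C y.
  by move=> Cx; apply: open_nbhs_nbhs; split => //; exact: open_component.
have power0 x : C x -> sphere_power n a (X x) = 0.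
  move=> Cx; have [E [E_on E_test]] := shrinker_test X_shrinker x.
  have [|_] := E_test _ _ _ (has_hessian_comparison sg a).
    by apply: filterS (near_C x Cx) => y Cy; rewrite (const y Cy) (const x Cx).
  rewrite drift_comparison// oppr_ge0 => side_le0.
  have : sg * sphere_power n a (X x) == 0 by rewrite eq_le side_le0 one_side.
  by rewrite mulf_eq0; case: sgE => ->; rewrite ?oppr_eq0 oner_eq0 => /eqP.
have dist_eq x : C x -> dot (X x - 2 *: a) (X x - 2 *: a) =
    2 * n%:R - 2 * dot a (X x) + 4 * dot a a.
  move=> Cx; have /eqP := power0 x Cx; rewrite subr_eq0 => /eqP <-.
  by rewrite !(dotBl, dotBr, dotZl, dotZr) (dotC _ a); ring.
have sg_neq0 : sg != 0 by case: sgE => ->; rewrite ?oppr_eq0 oner_eq0.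
have aX_const x : C x -> dot a (X x) = dot a (X p).
  move=> Cx; have := const x Cx; rewrite /comparison => /(mulfI sg_neq0).
  by rewrite !dist_eq//; lra.
have aX0 : dot a (X p) = 0.
  have [E [E_on E_test]] := shrinker_test X_shrinker p.
  have [|_] := E_test _ _ _ (has_hessian_affine a 0).
    by apply: filterS (near_C p Cp) => x Cx; rewrite aX_const.
  have [|_] := E_test _ _ _ (has_hessian_affine (- a) 0).
    by apply: filterS (near_C p Cp) => x Cx; rewrite !dotNl aX_const.
  by rewrite !drift_affine dotNl; lra.
have pd := power0 p Cp; split=> //; move: pd.
rewrite /sphere_power dotBl dotZl aX0 mulr0 subr0 => /eqP.
by rewrite subr_eq0 => /eqP.
Qed.

(** The point of the image closest to x turns out to be x: collinearity leaves
    only x and - x, and the second order test excludes - x. *)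
Lemma hypersurface_covers_sphere : (m <= n.+1)%N -> [set: S] !=set0 ->
  (forall p, dot (X p) (X p) = 2 * n%:R) ->
  forall x, dot x x = 2 * n%:R -> range X x.
Proof.
move=> codim [p _] X_norm x x_norm.
have cont : continuous (fun z : 'rV[R]_m => dot (- x) z + 0).
  exact: (has_hessian_continuous (has_hessian_affine (- x) 0)).
have [|q _ qmin] := proper_argmin X_shrinker X_proper (C := setT) (p := p) (b := 0)
    (k := 2 * n%:R) cont closedT I.
  by move=> y _ _; rewrite subr0 X_norm.
have [E [E_on E_test]] := shrinker_test X_shrinker q.
have [|xE] := E_test _ _ _ (has_hessian_affine (- x) 0).
  by apply: nearW => y; exact: qmin.
rewrite drift_affine dotNl mulrNN => xq_ge0.
(* the squared norm is constant, so its gradient X q is normal *)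
have [|qE _] := E_test _ _ _ (has_hessian_sqdist 0).
  by apply: nearW => y; rewrite !subr0 !X_norm.
have x_normal i : dot x (E i) = 0 by apply: oppr_inj; rewrite -dotNl xE oppr0.
have q_normal i : dot (X q) (E i) = 0.
  by have := qE i; rewrite subr0 dotZl => /eqP; rewrite mulf_eq0 pnatr_eq0 => /eqP.
have := orthonormal_codim1_collinear codim E_on x_normal q_normal.
rewrite x_norm X_norm -expr2 => /eqP; rewrite eqf_sqr => xq.
have {}xq : dot x (X q) = 2 * n%:R.
  have n2_ge0 : 0 <= 2 * n%:R :> R by rewrite mulr_ge0.
  by case/orP: xq => /eqP xq; move: xq_ge0; rewrite xq; lra.
exists q => //; apply/eqP; rewrite eq_sym -subr_eq0; apply/eqP/dot_eq0.
by rewrite dotBl !dotBr (dotC (X q)) xq x_norm X_norm; ring.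
Qed.

End ShrinkerAndSpheres.

Theorem theorem11 (R : realType) (m n : nat) (ltnm : (n < m)%N)
  (S : manifold R n) (S_nonempty : [set: S] !=set0)
  (X : S -> 'rV[R]_m)
  (X_shrinker : self_shrinker X)
  (X_complete : complete_immersed X)
  (X_proper : proper_map X) :
  (forall a : 'rV[R]_m,
     range X `&` esphere a (Num.sqrt (2 * n%:R + enorm a ^+ 2)) !=set0) /\
  (forall a : 'rV[R]_m,
     range X `<=` closure (eball a (Num.sqrt (2 * n%:R + enorm a ^+ 2))) \/
     range X `<=` ~` eball a (Num.sqrt (2 * n%:R + enorm a ^+ 2)) ->
     range X `<=` esphere a (Num.sqrt (2 * n%:R + enorm a ^+ 2)) /\
     (n = (m - 1)%N -> range X = esphere 0 (Num.sqrt (2 * n%:R)))).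
Proof.
split=> a.
  have [p p0] := sphere_power_vanishes X_shrinker X_proper a S_nonempty.
  by exists (X p); split; [exists p|apply/esphere_power].
move=> one_side.
have [sg sgE side] : exists2 sg : R, sg = 1 \/ sg = -1 &
    forall x, 0 <= sg * sphere_power n a (X x).
  case: one_side => X_sub.
  - exists (-1) => [|x]; first by right.
    have /closure_eball_sub := X_sub _ (ex_intro2 _ _ x I erefl).
    by rewrite mulN1r oppr_ge0 sphere_powerE subr_le0.
  - exists 1 => [|x]; first by left.
    have := X_sub _ (ex_intro2 _ _ x I erefl).
    by rewrite mul1r sphere_powerE subr_ge0 leNgt => h; apply/negP => /eballE.
have on_sphere := one_sided_on_sphere X_shrinker X_proper sgE side.
have X_norm p : dot (X p) (X p) = 2 * n%:R := (on_sphere p).2.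
have n2_ge0 : 0 <= 2 * n%:R :> R by rewrite mulr_ge0.
split=> [_ [p _ <-]|nE]; first by apply/esphere_power; exact: (on_sphere p).1.
apply/seteqP; split=> [_ [p _ <-]|x]; first by apply/esphereE; rewrite ?subr0.
move=> /(esphereE _ _ n2_ge0); rewrite subr0.
apply: (hypersurface_covers_sphere X_shrinker X_proper) => //.
by rewrite nE subn1 prednK// (leq_ltn_trans _ ltnm).
Qed.
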